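(* Let $k$ be a number field, $G$ a finite abelian group and $S$ a finite set of places of $k$. Then there exists an abelian extension $K/k$ with Galois group $G$ such that every $S$-unit of $k$ is a norm from $K$.
   Context: An element $\alpha\in k^*$ is a norm from $K$ if $\alpha\in N_{K/k}(K^* )$. An $S$-unit of $k$ is an element of $k^*$ which has valuation $0$ at every non-archimedean place of $k$ not in $S$. *)

(* Defs.v *)
From HB Require Import structures.
From mathcomp Require Import all_boot all_order all_algebra all_fingroup all_field.
From mathcomp Require Import boolp classical_sets cardinality reals exp.

Set Implicit Arguments.
Unset Strict Implicit.
Unset Printing Implicit Defensive.

Import Order.TTheory GRing.Theory Num.Theory.

Local Open Scope ring_scope.
Local Open Scope classical_set_scope.

Definition absolute_value (R : realType) (k : fieldType) (v : k -> R) : Prop :=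
  [/\ forall x, 0 <= v x,
      forall x, v x = 0 <-> x = 0,
      forall x y, v (x * y) = v x * v y
    & forall x y, v (x + y) <= v x + v y].

Definition nontrivial_absolute_value
    (R : realType) (k : fieldType) (v : k -> R) : Prop :=
  absolute_value v /\ exists2 x, x != 0 & v x != 1.

Definition equiv_absolute_value
    (R : realType) (k : fieldType) (v w : k -> R) : Prop :=
  exists2 c : R, 0 < c & forall x, w x = v x `^ c.

(* [place R k] is provably independent of the choice of the model [R] of the
   real numbers. *)
Record place (R : realType) (k : fieldType) : Type := Place {
  place_set : set (k -> R);
  _ : exists2 v, nontrivial_absolute_value v &
        place_set = [set w | absolute_value w /\ equiv_absolute_value v w]
}.

Definition nonarchimedean
    (R : realType) (k : fieldType) (p : place R k) : Prop :=
  forall v, place_set p v -> forall x y, v (x + y) <= Num.max (v x) (v y).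

(* Changing the representative [v] of a place rescales this valuation by a
   positive constant, so its vanishing at [x] depends on the place only. *)
Definition valuation
    (R : realType) (k : fieldType) (v : k -> R) (x : k) : R := - ln (v x).

Definition S_unit (R : realType) (k : fieldType) (S : set (place R k))
    (x : k) : Prop :=
  x != 0 /\
  forall p : place R k, nonarchimedean p -> ~ S p ->
    forall v, place_set p v -> valuation v x = 0.

Definition is_norm (k : fieldType) (K : splittingFieldType k) (a : k) : Prop :=
  exists2 b : K, b != 0 & galNorm 1 {:K} b = a%:A.

(* Main.v *)
Require Import Defs.
From HB Require Import structures.
From mathcomp Require Import boolp classical_sets functions cardinality.
From mathcomp Require Import reals sequences exp.
From mathcomp Require Import all_boot all_order all_algebra all_fingroup all_solvable all_field.
From mathcomp Require Import complex ring zify.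

(* The S-units fall into finitely many classes modulo |G|-th powers, and a |G|-th
   power of k is a norm from any extension of degree |G|; so only finitely many
   elements alpha have to be made norms. This is done one cyclic factor of G at
   a time: if K/k is Galois and alpha = N_{K/k}(z), one looks for a character chi
   of k of order N, still of order N over K, such that z is a norm from the
   compositum of K with the extension cut out by chi.

   Let M be a Galois extension of k containing K, the N-th roots of unity and an
   N-th root of z, and let theta generate M over Q. Take for chi the transfer to k
   of the Kummer character of the N-th root of t - theta, for an integer t. By
   the projection formula the symbol (chi, z) is a sum of corestrictions of
   symbols over M, which vanish because z is an N-th power there; an explicit
   cochain and Hilbert 90 turn this into a norm equation, without any class field
   theory. The order of chi over K is N as soon as no product of the conjugates
   of t - theta in which t - theta itself has exponent 1 is a p-th power in M with
   p | N, and this is arranged at a prime having a factor of degree 1 in M.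

   For the finiteness of the classes of S-units: an element which is not integral
   over Z is large for some ultrametric absolute value, obtained from a maximal
   subring; hence the S-units with bounded logarithms at the places of S and at
   infinity are finite in number, and a discreteness argument as in Dirichlet's
   unit theorem applies. *)

Set Implicit Arguments.
Unset Strict Implicit.
Unset Printing Implicit Defensive.

Import Order.TTheory GRing.Theory Num.Theory.

Local Open Scope ring_scope.

(** * Field extensions and Galois groups *)

Lemma has_char0_alg (k : fieldExtType rat) (A : lalgType k) : has_char0 A.
Proof. by move=> p; rewrite pchar_lalg pchar_lalg pchar_num. Qed.

Lemma separable_char0 (k : fieldExtType rat) (L : fieldExtType k)
  (K E : {subfield L}) : separable K E.
Proof.
by apply/separableP => y _; apply: pcharf0_separable; apply: has_char0_alg.
Qed.

Lemma galois1f (k : fieldExtType rat) (L : splittingFieldType k)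
  (K : {subfield L}) : galois K {:L}.
Proof. by rewrite /galois subvf separable_char0 normalFieldf. Qed.

Lemma primitive_element (F : fieldType) (L : fieldExtType F) :
  has_char0 L -> exists x : L, <<1; x>>%VS = fullv.
Proof.
move=> L0; have sep : separable (1%AS : {subfield L}) {:L}.
  by apply/separableP => y _; apply: pcharf0_separable.
by exists (separable_generator 1 {:L}); rewrite -eq_adjoin_separable_generator ?sub1v.
Qed.

Lemma generator_poly (F : fieldType) (L : fieldExtType F) (x : L) :
  <<1; x>>%VS = fullv ->
  forall y : L, exists p : {poly F}, y = (map_poly (in_alg L) p).[x].
Proof. by move=> Dx y; apply/Fadjoin1_polyP; rewrite Dx memvf. Qed.

(** Since [L] is [F[X]] modulo [m], the map [x |-> a] extends: [e y] evaluates at [a] any polynomial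
    in [x] representing [y]. Two representatives differ by a multiple of the minimal polynomial,
    which kills [a]; this independence also gives additivity and multiplicativity. *)
Lemma embed_simple (F : fieldType) (L : fieldExtType F) (x : L) (A : fieldType)
    (phi : {rmorphism F -> A}) (m : {poly F}) (a : A) :
  <<1; x>>%VS = fullv -> map_poly (in_alg L) m = minPoly 1 x ->
  root (map_poly phi m) a ->
  exists2 e : {rmorphism L -> A}, forall c, e c%:A = phi c & e x = a.
Proof.
move=> Dx Dm ma0; have px := generator_poly Dx.
pose p y := projT1 (cid (px y)); have pE y : y = (map_poly (in_alg L) (p y)).[x].
  by rewrite /p; case: cid.
pose e y := (map_poly phi (p y)).[a].
have eE y q : y = (map_poly (in_alg L) q).[x] -> e y = (map_poly phi q).[a].
  move=> yq; apply/eqP; rewrite -subr_eq0 /e -hornerN -hornerD -!rmorphB /=.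
  have: minPoly 1 x %| map_poly (in_alg L) (p y - q).
    apply: minPoly_dvdp; first by apply/polyOver1P; exists (p y - q).
    by rewrite /root rmorphB /= hornerD hornerN -pE -yq subrr.
  rewrite -Dm dvdp_map => /dvdpP[r ->].
  by rewrite rmorphM /= hornerM (rootP ma0) mulr0.
have e1 : e 1 = 1 by rewrite (eE 1 1) ?rmorph1 ?hornerC.
have eB : zmod_morphism e.
  move=> y z; rewrite (eE (y - z) (p y - p z)) ?rmorphB ?hornerD ?hornerN //=.
  by rewrite -!pE.
have eM : monoid_morphism e.
  split=> // y z; rewrite (eE (y * z) (p y * p z)) ?rmorphM ?hornerM //=.
  by rewrite -!pE.
pose eZ := GRing.isZmodMorphism.Build _ _ e eB.
pose eMM := GRing.isMonoidMorphism.Build _ _ e eM.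
pose er : {rmorphism L -> A} := HB.pack e eZ eMM.
exists er => [c|].
  rewrite /= (eE _ c%:P) ?map_polyC ?hornerC //=.
by rewrite /= (eE _ 'X) ?map_polyX ?hornerX.
Qed.

Lemma ahom_of_rmorph (F : fieldType) (K L : fieldExtType F)
    (e : {rmorphism K -> L}) : (forall c : F, e c%:A = c%:A) ->
  exists f : 'AHom(K, L), f =1 e.
Proof.
move=> eA; have eZ : scalable e.
  by move=> c y; rewrite -mulr_algl rmorphM eA mulr_algl.
pose eZm := GRing.isScalable.Build _ _ _ _ e eZ.
pose el : {linear K -> L} := HB.pack (GRing.RMorphism.sort e) (GRing.RMorphism.class e) eZm.
have eM : ahom_in fullv (linfun el).
  apply/ahomP_tmp; split; first by rewrite lfunE /= rmorph1.
  by move=> y z; rewrite !lfunE /= rmorphM.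
by exists (AHom eM) => y; exact: (lfunE el y).
Qed.

Lemma irreducible_factor (F : fieldType) (p : {poly F}) : (1 < size p)%N ->
  exists2 r, r %| p & irreducible_poly r.
Proof.
have [n] := ubnP (size p); elim: n p => // n IHn p lpn p1.
have [/asboolP irr|] := boolP `[<irreducible_poly p>]; first by exists p.
move=> /asboolP nirr; have [[q [q1 qp nqp]]|H] :=
  pselect (exists q : {poly F}, [/\ size q != 1%N, q %| p & ~~ (q %= p)]).
  have p0 : p != 0 by rewrite -size_poly_gt0 ltnW.
  have q0 : q != 0 by apply: dvdpN0 qp p0.
  have sq : (size q < size p)%N.
    by rewrite ltn_neqAle dvdp_leq // andbT dvdp_size_eqp.
  have [||r rq irr] := IHn q; first exact: leq_trans sq _.
    by rewrite ltn_neqAle eq_sym q1 size_poly_gt0.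
  by exists r => //; apply: dvdp_trans qp.
case: nirr; split=> // q q1 qp; apply: contrapT => /negP nqp.
by apply: H; exists q.
Qed.

Lemma splitting_field_ext (F : fieldType) (p : {poly F}) : p != 0 ->
  exists L : fieldExtType F, exists rs : seq L,
    map_poly (in_alg L) p %= \prod_(z <- rs) ('X - z%:P).
Proof.
have [n] := ubnP (size p); elim: n F p => // n IHn F p lpn p0.
have [sp|sp] := leqP (size p) 1.
  exists F^o, [::].
  by rewrite big_nil -size_poly_eq1 size_map_poly eqn_leq sp size_poly_gt0.
have [r rp /irredp_FAdjoin[K _ [x rx0 _]]] := irreducible_factor sp.
have /factor_theorem[q Dp] : root (map_poly (in_alg K) p) x.
  by rewrite -(divpK rp) rmorphM rootM rx0 orbT.
have Dsp: size p = size (q * ('X - x%:P)) by rewrite -Dp size_map_poly.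
have q0: q != 0.
  by move: p0; rewrite -size_poly_eq0 Dsp size_poly_eq0 mulf_eq0 => /norP[].
have [|//|L [rs Dq]] := IHn K q.
  by rewrite ltnS Dsp size_mul ?polyXsubC_eq0 ?size_XsubC ?addn2 in lpn.
exists (baseFieldType L), (x%:A :: rs).
rewrite (eq_map_poly (fun a : F => baseField_scaleE a 1)).
rewrite (map_poly_comp (in_alg L) (in_alg K)) Dp big_cons rmorphM /=.
by rewrite mulrC rmorphB /= map_polyX map_polyC eqp_mull.
Qed.

(** Makes a subfield of [L] an extension in its own right, embedded by [j]; the roots that generate
    [E] are pulled back to it. *)
Lemma subfield_type (F : fieldType) (L : fieldExtType F) (E : {subfield L})
    (p : {poly F}) : splittingFieldFor 1 (map_poly (in_alg L) p) E ->
  exists (S : splittingFieldType F) (j : 'AHom(S, L)),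
    limg j = E /\ splittingFieldFor 1 (map_poly (in_alg S) p) {:S}.
Proof.
case=> ys Dp defE; pose S0 := subvs_of E; pose toL := linfun (vsval : S0 -> L).
have [zs Dys]: {zs | map toL zs = ys}.
  exists (map (vsproj _) ys); rewrite -map_comp map_id_in // => y ys_y.
  by rewrite /= lfunE /= vsprojK // -defE seqv_sub_adjoin.
have split : splittingFieldFor 1 (map_poly (in_alg S0) p) {:S0}.
  exists zs.
    have: map_poly toL (map_poly (in_alg S0) p) %=
        map_poly toL (\prod_(z <- zs) ('X - z%:P)).
      rewrite -Dys big_map in Dp; apply: etrans Dp; apply: congr2.
        by rewrite -map_poly_comp; apply/eq_map_poly=> x; apply: rmorph_alg.
      rewrite rmorph_prod; apply/eq_bigr=> z _.
      by rewrite rmorphB /= map_polyX map_polyC.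
    by rewrite eqp_map.
  apply/vspaceP=> u.
  have: val u \in (toL @: <<1 & zs>>)%VS.
    by rewrite aimg_adjoin_seq aimg1 Dys [in X in _ \in X]defE (valP u).
  by case/memv_imgP=> v Lzs_v; rewrite memvf lfunE => /val_inj->.
have ax : SplittingField.axiom S0.
  by exists (map_poly (in_alg S0) p) => //; apply/polyOver1P; exists p.
pose mix := FieldExt_isSplittingField.Build F S0 ax.
pose S : splittingFieldType F := HB.pack S0 mix.
have [j jE] := ahom_of_rmorph (K := S) (e := toL) (rmorph_alg _).
exists S, j; split=> //; apply/vspaceP => x; apply/memv_imgP/idP => [[y _ ->]|xE].
  by rewrite jE /= lfunE; apply: subvsP.
by exists (vsproj E x); rewrite ?memvf // jE /= lfunE /= vsprojK.
Qed.

Lemma splitting_field (F : fieldType) (p : {poly F}) : p != 0 ->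
  exists L : splittingFieldType F,
    splittingFieldFor 1 (map_poly (in_alg L) p) {:L}.
Proof.
move=> p0; have [L [ys Dp]] := splitting_field_ext p0.
have [|S [_ [_ splitS]]] := @subfield_type _ _ <<1 & ys>>%AS p; first by exists ys.
by exists S.
Qed.

Lemma minPoly1_poly (F : fieldType) (L : fieldExtType F) (x : L) :
  exists2 m : {poly F}, map_poly (in_alg L) m = minPoly 1 x & m != 0.
Proof.
have /polyOver1P[m Dm] := minPolyOver 1 x; exists m => //.
by rewrite -(map_poly_eq0 (in_alg L)) -Dm monic_neq0 // monic_minPoly.
Qed.

Lemma dvdp_split_root (F : fieldType) (p q : {poly F}) (rs : seq F) :
  p %= \prod_(z <- rs) ('X - z%:P) -> q %| p -> (1 < size q)%N ->
  exists z, root q z.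
Proof.
move=> Dp qp q1; have := qp; rewrite (eqp_dvdr _ Dp).
case/dvdp_prod_XsubC => m Dq.
case Em : (mask m rs) => [|z s].
  by move: Dq; rewrite Em big_nil => /eqp_size; rewrite size_poly1 => E; rewrite E in q1.
by exists z; rewrite (eqp_root Dq) Em root_prod_XsubC inE eqxx.
Qed.

Lemma radical_extension (k : fieldExtType rat) (K : splittingFieldType k)
    (zs : seq K) (N : nat) : (0 < N)%N ->
  exists (M : splittingFieldType k) (i : 'AHom(K, M)),
    (exists zeta : M, N.-primitive_root zeta) /\
    (forall z, z \in zs -> exists a : M, a ^+ N = i z).
Proof.
move=> N0; have [x Dx] := primitive_element (@has_char0_alg k K).
pose mp (z : K) : {poly k} := projT1 (cid2 (minPoly1_poly z)).
have mpE z : map_poly (in_alg K) (mp z) = minPoly 1 z by rewrite /mp; case: cid2.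
have mp0 z : mp z != 0 by rewrite /mp; case: cid2.
have Xsz : size ('X^N : {poly k}) = N.+1 by rewrite size_polyXn.
have cX0 z : mp z \Po 'X^N != 0.
  by rewrite comp_poly_eq0 // size_polyXn ltnS.
(* One splitting field serves three ends: a root of the first factor embeds [K], the second gives
   the roots of unity, and over [M] the third has the factor ['X^N - i z] for each [z]. *)
pose P := mp x * (('X^N - 1) * \prod_(z <- zs) (mp z \Po 'X^N)).
have P0 : P != 0.
  rewrite !mulf_neq0 //; first by rewrite -size_poly_eq0 size_XnsubC.
  by elim/big_ind: _ => [|p q|z _]; rewrite ?oner_neq0 //; apply: mulf_neq0.
have [M [rs DP _]] := splitting_field P0; exists M.
pose pM := map_poly (in_alg M).
have dv q : q %| P -> pM q %| pM P by rewrite dvdp_map.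
have [|a ma] := dvdp_split_root DP (dv (mp x) (dvdp_mulr _ (dvdpp _))).
  rewrite size_map_poly -(size_map_poly (in_alg K)) mpE size_minPoly ltnS.
  by rewrite adjoin_degreeE dimv1 divn1 adim_gt0.
have [e eA _] := embed_simple Dx (mpE x) ma.
have [i iE] := ahom_of_rmorph eA; exists i; split.
  have := dv _ (dvdp_mull (mp x) (dvdp_mulr _ (dvdpp ('X^N - 1)))).
  rewrite (eqp_dvdr _ DP) /pM rmorphB /= map_polyXn rmorph1.
  case/dvdp_prod_XsubC => m Dq; set ss := mask m rs in Dq.
  have nz : (N%:R : M) != 0 by rewrite ((pcharf0P M).1 (@has_char0_alg k M)) gtn_eqF.
  have us : uniq ss.
    by rewrite -separable_prod_XsubC -(eqp_separable Dq) separable_Xn_sub_1.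
  have uni : all N.-unity_root ss.
    apply/allP => z zs'; rewrite /= /root_of_unity.
    by rewrite (eqp_root Dq) root_prod_XsubC.
  have sz : (N <= size ss)%N.
    by rewrite -ltnS -(size_prod_XsubC ss id) -(eqp_size Dq) size_XnsubC.
  by have /hasP[z _ zp] := has_prim_root N0 uni us sz; exists z.
move=> z zsz; have rz : root (pM (mp z)) (i z).
  rewrite /root; apply/eqP.
  have -> : pM (mp z) = map_poly i (map_poly (in_alg K) (mp z)).
    by rewrite -map_poly_comp; apply: eq_map_poly => c /=; rewrite iE eA.
  by rewrite horner_map mpE (rootP (root_minPoly _ _)) rmorph0.
have : 'X^N - (i z)%:P %| pM P.
  apply: dvdp_trans (dv (mp z \Po 'X^N) _).
    have /factor_theorem[q Dq] := rz.
    rewrite /pM map_comp_poly -/(pM (mp z)) Dq map_polyXn.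
    by rewrite comp_polyM rmorphB /= comp_polyX comp_polyC dvdp_mull.
  rewrite /P !dvdp_mull // (big_rem z zsz) /= dvdp_mulr //.
move=> dz; have [|b] := dvdp_split_root DP dz; first by rewrite size_XnsubC.
by rewrite /root !hornerE subr_eq0 => /eqP <-; exists b.
Qed.

(** * Transport of Galois groups and norms along an embedding *)

Section Transfer.
Variables (k : fieldType) (K L : splittingFieldType k) (i : 'AHom(K, L)).

Lemma ahom_inj : injective i.
Proof. exact: fmorph_inj. Qed.

Lemma ahom_lker0 : lker i == 0%VS.
Proof. by apply/lker0P; apply: ahom_inj. Qed.

Lemma mem_limg_ahom x : i x \in limg i.
Proof. by rewrite memv_img ?memvf. Qed.

Lemma normalField_limg : normalField 1 (limg i).
Proof.
apply/splitting_normalField; first exact: sub1v.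
have [p /polyOver1P[q ->] [rs Dp genK]] := splittingFieldP K.
exists (map_poly (in_alg L) q); first by apply/polyOver1P; exists q.
exists (map i rs); last first.
  transitivity (i @: <<1 & rs>>)%VS; last by rewrite genK.
  by rewrite aimg_adjoin_seq aimg1.
have -> : map_poly (in_alg L) q = map_poly i (map_poly (in_alg K) q).
  by rewrite -map_poly_comp; apply: eq_map_poly => c /=; rewrite rmorph_alg.
have -> : \prod_(z <- map i rs) ('X - z%:P) = map_poly i (\prod_(z <- rs) ('X - z%:P)).
  rewrite big_map rmorph_prod; apply: eq_bigr => z _.
  by rewrite rmorphB /= map_polyX map_polyC.
by rewrite eqp_map.
Qed.

Lemma ahom_pullback (s : 'AEnd(L)) : (s @: limg i <= limg i)%VS ->
  exists s0 : gal_of {:K}, forall x, s (i x) = i (s0 x).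
Proof.
move=> sI; pose f := (i^-1 \o (s \o i))%VF.
have fE x : i (f x) = s (i x).
  rewrite /f !lfunE /= lfunE /= limg_lfunVK //.
  by apply: (subvP sI); apply: memv_img; apply: mem_limg_ahom.
have fM : ahom_in fullv f.
  apply/ahomP_tmp; split.
    by apply: ahom_inj; rewrite fE !rmorph1.
  by move=> x y; apply: ahom_inj; rewrite fE !rmorphM /= -!fE.
exists (gal {:K} (AHom fM)) => x.
by rewrite galK ?memvf ?subvf //= fE.
Qed.

Lemma gal_pullback (s : gal_of {:L}) :
  exists s0 : gal_of {:K}, forall x, s (i x) = i (s0 x).
Proof.
apply: ahom_pullback; have /forall_inP/(_ s) := normalField_limg.
by rewrite inE kAutfE k1AHom => /(_ isT)/eqP->.
Qed.


Lemma gal_pushforward (s0 : gal_of {:K}) :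
  exists s : gal_of (limg i), forall x, s (i x) = i (s0 x).
Proof.
pose f := (i \o (s0 \o i^-1))%VF.
have fE x : f (i x) = i (s0 x).
  by rewrite /f lfunE /= lfunE /= lker0_lfunK ?ahom_lker0.
have kf : kAut 1 (limg i) f.
  rewrite kAutE; apply/andP; split; last first.
    apply/subvP=> _ /memv_imgP[_ /memv_imgP[x _ ->] ->].
    by rewrite fE mem_limg_ahom.
  apply/kHomP_tmp; split.
    by move=> _ /vlineP[c ->]; rewrite -(rmorph_alg i) fE (rmorph_alg s0).
  move=> _ _ /memv_imgP[x _ ->] /memv_imgP[y _ ->].
  by rewrite -rmorphM /= !fE !rmorphM.
have [s _ Ds] := kAut_to_gal kf; exists s => x.
by rewrite -Ds ?mem_limg_ahom ?fE.
Qed.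

Definition gal_push s0 := projT1 (cid (gal_pushforward s0)).

Lemma gal_pushE s0 x : gal_push s0 (i x) = i (s0 x).
Proof. by rewrite /gal_push; case: cid. Qed.

Lemma gal_push_bij : bijective gal_push.
Proof.
have pull (s : gal_of (limg i)) : exists s0 : gal_of {:K},
    forall x, s (i x) = i (s0 x).
  by apply: ahom_pullback; rewrite limg_gal.
exists (fun s => projT1 (cid (pull s))) => [s0|s].
  case: cid => t /= tE; apply/eqP/gal_eqP => x _; apply: ahom_inj.
  by rewrite -tE gal_pushE.
case: cid => t /= tE; apply/eqP/gal_eqP => _ /memv_imgP[x _ ->].
by rewrite gal_pushE -tE.
Qed.

Lemma mem_gal1 (E : {subfield L}) (s : gal_of E) : s \in 'Gal(E / 1)%g.
Proof. by rewrite gal_kHom ?sub1v ?k1AHom. Qed.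

Lemma gal_limg_isog : ('Gal({:K} / 1) \isog 'Gal(limg i / 1))%g.
Proof.
have pM : {in 'Gal({:K} / 1)%g &, {morph gal_push : x y / (x * y)%g}}.
  move=> s t _ _; apply/eqP/gal_eqP => _ /memv_imgP[x _ ->].
  by rewrite galM ?mem_limg_ahom // !gal_pushE galM ?memvf.
apply/isogP; exists (Morphism pM).
  by apply/injmP => s t _ _; apply: (bij_inj gal_push_bij).
apply/setP=> s; rewrite [RHS]mem_gal1; apply/morphimP.
have [g _ gK] := gal_push_bij; exists (g s); rewrite ?gK //;
  by rewrite gal_kHom ?sub1v ?k1AHom.
Qed.

Lemma galNorm_limg x : i (galNorm 1 {:K} x) = galNorm 1 (limg i) (i x).
Proof.
rewrite /galNorm rmorph_prod /= [RHS](reindex gal_push) /=; last first.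
  by apply: onW_bij; apply: gal_push_bij.
apply: eq_big => s; last by rewrite gal_pushE.
by rewrite mem_gal1 gal_kHom ?sub1v ?k1AHom.
Qed.
End Transfer.

(** Restriction to [M] maps Gal(E/F) onto Gal(M/F), and its fibres are the cosets of Gal(E/M);
    grouping the product by fibres gives the inner norm. *)
Lemma galNorm_tower (k : fieldType) (L : splittingFieldType k)
    (F M E : {subfield L}) a :
  galois F E -> normalField F M -> (F <= M <= E)%VS -> a \in E ->
  galNorm F E a = galNorm F M (galNorm M E a).
Proof.
move=> galFE nFM sFME aE; have [sFM sME] := andP sFME.
have galME : galois M E by apply: galoisS galFE; rewrite sFM.
pose c := normalField_cast M (E := E).
have cimg s : s \in 'Gal(E / F)%g -> c s \in 'Gal(M / F)%g.
  move=> sG; rewrite gal_kHom //; apply/kAHomP => x Fx; rewrite /c.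
  rewrite (normalField_cast_eq sFME nFM sG) ?(subvP sFM) //.
  by rewrite (fixed_gal (subv_trans sFM sME)).
rewrite /galNorm (partition_big c [in 'Gal(M / F)%g]) //=.
apply: eq_bigr => t tG.
have [s0 s0G ct] : exists2 s0, s0 \in 'Gal(E / F)%g & t = c s0.
  move: tG; rewrite -(normalField_img galFE sFME nFM).
  by case/morphimP => s0 _ s0G ->; exists s0.
have NM : galNorm M E a \in M by apply: mem_galNorm.
have -> : t (galNorm M E a) = s0 (galNorm M E a).
  by rewrite ct /c (normalField_cast_eq sFME nFM s0G).
rewrite rmorph_prod /= (reindex_inj (mulIg s0)) /=.
apply: eq_big => u; last by rewrite galM.
apply/andP/idP => [[usG /eqP cu]|uM].
  have uG : u \in 'Gal(E / F)%g by rewrite groupMr in usG.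
  rewrite -(normalField_ker sFME nFM); apply/kerP => //=.
  have := normalField_castM sFME nFM uG s0G; rewrite -/(c _) -/(c _) cu ct.
  by move=> /esym/(canRL (mulgK _)); rewrite mulgV.
have uG : u \in 'Gal(E / F)%g by apply: subsetP uM; apply: galS.
split; first by rewrite groupM.
have := normalField_castM sFME nFM uG s0G; rewrite -/(c _) -/(c _) ct => ->.
move: uM; rewrite -(normalField_ker sFME nFM) => /mker /= cu1.
by rewrite /c cu1 mul1g.
Qed.

(** * Norms from cyclic extensions *)

(** The sum of [Z y * y a] over [G] has the required behaviour for every [a]; independence of
    automorphisms provides an [a] for which it is nonzero. *)
Lemma hilbert90_cocycle (k : fieldType) (L : splittingFieldType k)
    (G : {group gal_of {:L}}) (Z : gal_of {:L} -> L) :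
  (forall s, s \in G -> Z s != 0) ->
  {in G &, forall s t, Z s * s (Z t) = Z (t * s)%g} ->
  exists2 u, u != 0 & forall s, s \in G -> Z s * s u = u.
Proof.
move=> Z0 ZM; have [a _ u0] := gal_independent_contra (group1 G) (Z0 _ (group1 G)).
exists (\sum_(y in G) Z y * y a) => // s sG.
rewrite rmorph_sum mulr_sumr [RHS](reindex_inj (mulIg s)) /=.
apply: eq_big => t; first by rewrite groupMr.
by move=> tG; rewrite rmorphM mulrA ZM // galM ?memvf.
Qed.

(* [l] is a lift to [nat] of a character to Z/N, and the hypothesis on [V] says
   that [V s / alpha ^ (l s / N)] trivialises the cup product of this character
   with [alpha]. Products of Galois elements compose from left to right:
   [(t * s) a = s (t a)]. *)
Section CyclicNorm.
Variables (k : fieldType) (L : splittingFieldType k) (D : {group gal_of {:L}}).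
Variables (N : nat) (alpha : L) (l : gal_of {:L} -> nat) (V : gal_of {:L} -> L).
Hypotheses (N1 : (1 < N)%N) (alpha0 : alpha != 0).
Hypothesis fix_alpha : forall s, s \in D -> s alpha = alpha.
Hypothesis V0 : forall s, s \in D -> V s != 0.
Hypothesis VM : {in D &, forall s t, exists2 c,
  (l s + l t = l (t * s)%g + N * c)%N & V s * s (V t) = V (t * s)%g * alpha ^+ c}.
Variable sigma : gal_of {:L}.
Hypotheses (sD : sigma \in D) (lsigma : (l sigma = 1 %[mod N])%N).

Let D0 := [set s in D | (N %| l s)%N].

Let D0_group : group_set D0.
Proof.
apply/group_setP; split=> [|s t].
  rewrite inE group1 /=; have [c + _] := VM (group1 D) (group1 D).
  by rewrite mulg1 => /eqP; rewrite eqn_add2l => /eqP->; rewrite dvdn_mulr.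
rewrite !inE => /andP[sD' sN] /andP[tD tN]; rewrite groupM //=.
have [c + _] := VM tD sD'; move=> E.
by rewrite -(dvdn_addl _ (dvdn_mulr c (dvdnn N))) -E dvdn_add.
Qed.

(** Hilbert 90 on the kernel of the character writes the cocycle there as a coboundary, through some
    [u]. After twisting by [u], the value of [V] at [sigma], divided by a power of [alpha], is
    invariant under the kernel, and the product of its conjugates telescopes to [alpha]. *)
Lemma cyclic_norm : exists w : L, [/\ w != 0,
  forall s, s \in D -> (N %| l s)%N -> s w = w
  & \prod_(i < N) (sigma ^+ i)%g w = alpha].
Proof.
pose G := group D0_group; have N0 : (0 < N)%N by apply: ltnW.
have GP s : reflect (s \in D /\ (N %| l s)%N) (s \in G).
  by rewrite inE; apply: andP.
(* On the kernel of the character this is a genuine 1-cocycle. *)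
pose Z s := V s / alpha ^+ (l s %/ N).
have Z0 s : s \in G -> Z s != 0.
  by case/GP=> sD' _; rewrite mulf_neq0 ?V0 ?invr_neq0 ?expf_neq0.
have ZM : {in G &, forall s t, Z s * s (Z t) = Z (t * s)%g}.
  move=> s t sG tG; have /GP[_ tsN] := groupM tG sG.
  have /GP[sD' sN] := sG; have /GP[tD tN] := tG.
  rewrite /Z rmorphM fmorphV rmorphXn /= fix_alpha // mulrACA.
  have [c lE ->] := VM sD' tD; rewrite -invfM -exprD.
  have -> : (l s %/ N + l t %/ N = l (t * s)%g %/ N + c)%N.
    by rewrite -divnDl // lE addnC mulnC divnMDl // addnC.
  by rewrite exprD invfM [_^-1 * _^-1]mulrC mulrA mulfK ?expf_neq0.
have [u u0 Zu] := hilbert90_cocycle Z0 ZM.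
have s0 (s : gal_of {:L}) x : x != 0 -> s x != 0 by rewrite fmorph_eq0.
have Vu s : s \in G -> V s * s u = alpha ^+ (l s %/ N) * u.
  move=> sG; rewrite -[in RHS](Zu s sG) /Z mulrA [_ * (V s / _)]mulrC.
  by rewrite mulfVK ?expf_neq0.
pose q := (l sigma %/ N)%N.
have lq : l sigma = (q * N + 1)%N.
  by rewrite [LHS](divn_eq _ N) lsigma (modn_small N1).
pose w := V sigma / alpha ^+ q * (sigma u / u).
exists w; split.
- by rewrite !mulf_neq0 ?invr_neq0 ?expf_neq0 ?V0 ?s0.
- move=> s sD' sN; have sG : s \in G by apply/GP.
  (* Both sides of [s' * sigma = sigma * s] are expanded by [VM]; comparing them gives the action of
     [s] on [V sigma] in terms of the values at [s] and [s'], which [Vu] controls. *)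
  pose s' := (sigma * s * sigma^-1)%g.
  have ss' : (s' * sigma = sigma * s)%g by rewrite /s' mulgKV.
  have s'D : s' \in D by rewrite !groupM ?groupV.
  have [c1 l1 V1] := VM sD' sD; have [c2 l2 V2] := VM sD s'D.
  rewrite ss' in l2 V2.
  have lc : (l s' + N * c1 = l s + N * c2)%N by lia.
  have s'N : (N %| l s')%N.
    by rewrite -(dvdn_addl _ (dvdn_mulr c1 (dvdnn N))) lc dvdn_add ?dvdn_mulr.
  have s'G : s' \in G by apply/GP.
  have := Vu s' s'G; have := Vu s sG.
  move=> Vs /(congr1 sigma); rewrite !rmorphM rmorphXn /= fix_alpha //.
  rewrite -(galM s' sigma) ?memvf // ss' galM ?memvf //.
  move=> Vs'; have Ac : (l s' %/ N + c1 = l s %/ N + c2)%N.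
    by have := congr1 (divn^~ N) lc; rewrite !(mulnC N) !divnDMl.
  have ne : V s * sigma (V s') != 0 by rewrite mulf_neq0 ?s0 ?V0.
  have E : s (V sigma) * s (sigma u) * u = V sigma * sigma u * s u.
    apply: (mulfI ne).
    move: V1 V2 Vs Vs' (congr1 (fun n => alpha ^+ n) Ac); rewrite !exprD.
    move: (V s) (V sigma) (s u) (sigma u) (sigma (V s')) (s (V sigma)) (s (sigma u)).
    move: (V _) (alpha ^+ _) (alpha ^+ _) (alpha ^+ _) (alpha ^+ _).
    move=> W a4 a3 a2 a1 x1 x2 x6 x7 x3 x4 x5 V1 V2 Vs Vs' Ea.
    transitivity ((x1 * x4) * (x3 * x5) * u); first by ring.
    transitivity ((x2 * x3) * (x1 * x6) * x7); last by ring.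
    rewrite V1 V2 Vs Vs'.
    transitivity (W * (a4 * a1) * x7 * u); first by ring.
    by rewrite Ea; ring.
  rewrite /w !fmorphV rmorphXn /= fix_alpha //.
  have u' := s0 s u u0; have a' := expf_neq0 q alpha0.
  have E2 : s (V sigma) * s (sigma u) / s u = V sigma * sigma u / u.
    by apply/eqP; rewrite eqr_div // E.
  rewrite mulrACA [X in _ * X = _]mulrC mulrA E2.
  by rewrite [RHS]mulrACA [X in _ = _ * X]mulrC [RHS]mulrA.
have VX j : exists2 c, ((j.+1) * l sigma = l (sigma ^+ j.+1)%g + N * c)%N
    & \prod_(i < j.+1) (sigma ^+ i)%g (V sigma) = V (sigma ^+ j.+1)%g * alpha ^+ c.
  elim: j => [|j [c lc Vc]].
    by exists 0%N; rewrite ?muln0 ?addn0 ?mul1n ?expg1 // big_ord1 gal_id expr0 mulr1.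
  have [d ld Vd] := VM (groupX j.+1 sD) sD; rewrite -expgS in ld Vd.
  exists (c + d)%N; first by rewrite mulSn lc mulnDr addnA (addnC (l sigma)) ld -addnA (addnC (N * d)%N).
  by rewrite big_ord_recr /= Vc mulrAC Vd exprD; ring.
have uX j : \prod_(i < j) (sigma ^+ i)%g (sigma u / u) = (sigma ^+ j)%g u / u.
  elim: j => [|j IH]; first by rewrite big_ord0 gal_id mulfV.
  rewrite big_ord_recr /= IH rmorphM fmorphV /= -galM ?memvf // -expgS.
  by rewrite mulrC mulrA mulfVK ?s0.
have [c lc Vc] := VX N.-1; rewrite (prednK N0) in lc Vc.
have sNG : (sigma ^+ N)%g \in G.
  apply/GP; rewrite groupX //; split=> //.
  by rewrite -(dvdn_addl _ (dvdn_mulr c (dvdnn N))) -lc dvdn_mulr.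
have wE i : (sigma ^+ i)%g w = (sigma ^+ i)%g (V sigma) * (alpha ^+ q)^-1 * (sigma ^+ i)%g (sigma u / u).
  by rewrite /w rmorphM [X in X * _]rmorphM fmorphV rmorphXn /= fix_alpha // groupX.
under eq_bigr => i _ do rewrite wE.
rewrite !big_split /= Vc uX prodr_const card_ord.
have := Vu _ sNG; set A := (_ %/ _)%N => VA.
(* Dividing [N * l sigma = l (sigma ^+ N) + N * c] by [N] shows that exactly one factor [alpha]
   survives the division by [alpha ^+ (q * N)]. *)
have Ac : (A + c = q * N + 1)%N.
  rewrite -lq; have := congr1 (divn^~ N) lc.
  by rewrite mulKn // (mulnC N) divnDMl // => ->.
rewrite exprVn -exprM.
transitivity ((V (sigma ^+ N)%g * (sigma ^+ N)%g u) * alpha ^+ c / alpha ^+ (q * N) / u).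
  by ring.
rewrite VA [_ * u * _]mulrAC -exprD Ac exprD expr1.
by rewrite [_ * u / _]mulrAC mulfK // mulrC mulKf ?expf_neq0.
Qed.
End CyclicNorm.

(** * Elements that are not powers *)

Lemma horner_taylor2 (R : comNzRingType) (F : {poly R}) (a h : R) :
  exists g, F.[a + h] = F.[a] + h * F^`().[a] + h ^+ 2 * g.
Proof.
elim/poly_ind: F => [|F c [g Fg]].
  by exists 0; rewrite deriv0 !horner0; ring.
exists (F^`().[a] + g * (a + h)).
by rewrite derivD derivM derivX derivC !hornerE Fg; ring.
Qed.

Lemma horner_congr (F : {poly int}) (m a b : int) :
  (m %| a - b)%Z -> (m %| F.[a] - F.[b])%Z.
Proof.
case/dvdzP => q E; have [g] := horner_taylor2 F b (a - b).
rewrite addrC subrK => ->; apply/dvdzP.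
by exists (q * F^`().[b] + (a - b) * q * g); rewrite E; ring.
Qed.

(** Newton iteration with a Bezout relation in place of division: if [u * p + v * F'(a) = 1] and
    [F(a) = y * h] with [h = p ^ (j + d)], then passing to [a - y * v * h] gains a factor [p], the
    second order term being divisible by [h ^ 2]. *)
Lemma hensel (F : {poly int}) (p : nat) (j : nat) (a0 : int) : prime p ->
  (0 < j)%N -> (p%:Z ^+ j %| F.[a0])%Z -> ~~ (p %| F^`().[a0])%Z ->
  forall d, exists2 a, (p%:Z ^+ (j + d) %| F.[a])%Z & (p%:Z ^+ j %| a - a0)%Z.
Proof.
move=> pp j0 Fa0 F'a0; elim=> [|d [a Fa aa0]].
  by exists a0; rewrite ?addn0 // subrr dvdz0.
have pa : (p %| a - a0)%Z.
  by apply: dvdz_trans aa0; rewrite -[j](prednK j0) exprS dvdz_mulr.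
have F'a : ~~ (p %| F^`().[a])%Z.
  apply: contra F'a0 => H; have := horner_congr F^`() pa.
  by move=> D; rewrite -[F^`().[a0]](subKr F^`().[a]) rpredB.
have : coprimez p F^`().[a].
  by rewrite /coprimez /gcdz eqz_nat -/(coprime _ _) prime_coprime.
case/coprimezP=> [[u v] /= uv].
case/dvdzP: Fa => y Fa; set h := p%:Z ^+ (j + d) in Fa.
have hE : h = p%:Z * p%:Z ^+ (j + d).-1 by rewrite -exprS prednK ?addn_gt0 ?j0.
have [g Fg] := horner_taylor2 F a (- (y * v) * h).
exists (a - (y * v) * h); last first.
  by rewrite addrAC rpredB // dvdz_mull // /h exprD dvdz_mulr.
apply/dvdzP; exists (y * u + (y * v) ^+ 2 * p%:Z ^+ (j + d).-1 * g).
rewrite -mulNr Fg Fa addnS [p%:Z ^+ _.+1]exprS -/h; clearbody h.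
move: (p%:Z ^+ _.-1) hE => P1 hE.
have -> : y * h = y * (u * p%:Z + v * F^`().[a]) * h by rewrite uv; ring.
by rewrite hE; ring.
Qed.

Lemma exists_nonroot (P : {poly int}) : P != 0 -> exists n : nat, P.[n%:Z] != 0.
Proof.
move=> P0; apply: contrapT => H; move/eqP: P0; apply.
apply: (@roots_geq_poly_eq0 _ _ [seq i%:Z | i <- iota 0 (size P)]).
- apply/allP => _ /mapP[i _ ->]; apply: contrapT => /negP Hi.
  by apply: H; exists i.
- by rewrite map_inj_uniq ?iota_uniq // => i j [].
- by rewrite size_map size_iota.
Qed.

(** Euclid's argument: if [c = F(0)] is nonzero, then [F(c * E * n) = c * q] with [q] congruent to 1
    modulo [E], so no prime divisor of [q] divides [E]. If [c = 0], any prime beyond [|E|] works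
    with [a = 0]. *)
Lemma prime_divisor_poly (F : {poly int}) (E : int) : (1 < size F)%N -> E != 0 ->
  exists (p : nat) (a : int), [/\ prime p, ~~ (p %| E)%Z & (p %| F.[a])%Z].
Proof.
move=> sF E0; have [c0|c0] := eqVneq F.[0] 0.
  have [p ltEp pp] := prime_above `|E|%N; exists p, (0 : int); split; rewrite ?c0 ?dvdz0 //.
  by apply/negP => /dvdn_leq; rewrite absz_gt0 => /(_ E0); rewrite leqNgt ltEp.
set c := F.[0] in c0.
pose G := F \Po ((c * E) *: 'X).
have GE y : G.[y] = F.[c * E * y] by rewrite horner_comp !hornerE.
have sG : size G = size F by rewrite size_comp_poly2 // size_scale ?size_polyX // mulf_neq0.
have Gc d : G - d%:P != 0.
  rewrite subr_eq0; apply/eqP => Gd; have := size_polyC_leq1 d.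
  by rewrite -Gd sG leqNgt sF.
(* Avoiding the values [c], [-c] and 0 keeps [q] away from 1, -1 and 0, so that it has a prime
   divisor. *)
have [n] : exists n : nat, ((G - c%:P) * (G - (- c)%:P) * (G - 0%:P)).[n%:Z] != 0.
  by apply: exists_nonroot; rewrite !mulf_neq0.
rewrite !hornerM !mulf_eq0 !negb_or !hornerD !hornerN !hornerC opprK.
case/andP=> /andP[]; rewrite subr_eq0 addr_eq0 subr0 => n1 n2 n3.
have [g Fg] := horner_taylor2 F 0 (c * E * n%:Z).
rewrite add0r -GE -/c in Fg.
pose q := 1 + E * (n%:Z * F^`().[0] + n%:Z * (c * E * n%:Z) * g).
have Gq : G.[n%:Z] = c * q by rewrite Fg /q; ring.
have q1 : `|q|%N != 1%N.
  apply/negP => /eqP H; have : q = 1 \/ q = -1 by lia.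
  by case=> Q; [move: n1|move: n2]; rewrite Gq Q ?mulr1 ?mulrN1 eqxx.
exists (pdiv `|q|%N), (c * E * n%:Z).
have pq : (pdiv `|q|%N %| q)%Z by exact: pdiv_dvd.
have pp : prime (pdiv `|q|%N).
  apply: pdiv_prime; rewrite ltn_neqAle eq_sym q1 absz_gt0.
  by move: n3; rewrite Gq mulf_eq0 negb_or => /andP[].
split=> //; last by rewrite -GE Gq dvdz_mull.
apply/negP => pE; have : (pdiv `|q|%N %| 1)%Z.
  by move: pq; rewrite /q rpredDr // dvdz_mulr.
by rewrite dvdz1 => /eqP; case: (pdiv _) pp => [|[|]].
Qed.

Lemma logn_absz_congr (p j : nat) (x y : int) : prime p -> x != 0 ->
  (logn p `|x| < j)%N -> (p%:Z ^+ j %| x - y)%Z -> logn p `|y| = logn p `|x|.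
Proof.
move=> pp x0 lj pj; have dE i (z : int) : z != 0 -> (p%:Z ^+ i %| z)%Z = (i <= logn p `|z|)%N.
  by move=> z0; rewrite dvdzE abszX -pfactor_dvdn // absz_gt0.
have dv i : (i <= j)%N -> (p%:Z ^+ i %| y)%Z = (p%:Z ^+ i %| x)%Z.
  move=> ij; have H : (p%:Z ^+ i %| x - y)%Z by apply: dvdz_trans pj; apply: dvdz_exp2l.
  by rewrite -[in RHS](subrK y x) rpredDl.
have y0 : y != 0.
  by apply/eqP => y0; have := dv j (leqnn j); rewrite y0 dvdz0 dE // leqNgt lj.
apply/eqP; rewrite eqn_leq -(dE _ _ y0) dv ?(ltnW lj) // dE // leqnn andbT.
by rewrite leqNgt -(dE _ _ y0) dv // dE // ltnn.
Qed.

Lemma ndvdzM (p : nat) (x y : int) : prime p ->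
  ~~ (p %| x)%Z -> ~~ (p %| y)%Z -> ~~ (p %| x * y)%Z.
Proof.
by move=> pp; rewrite !dvdzE abszM (Euclid_dvdM _ _ pp) negb_or => -> ->.
Qed.

Lemma ndvdzX (p : nat) (x : int) n : prime p -> ~~ (p %| x)%Z -> ~~ (p %| x ^+ n)%Z.
Proof.
move=> pp px; elim: n => [|n IH]; last by rewrite exprS ndvdzM.
by rewrite expr0 dvdz1 absz_nat; case: p pp {px} => [|[|]].
Qed.

Lemma ndvdz_prod (p : nat) (I : eqType) (r : seq I) (x : I -> int) : prime p ->
  (forall i, i \in r -> ~~ (p %| x i)%Z) -> ~~ (p %| \prod_(i <- r) x i)%Z.
Proof.
move=> pp px; rewrite big_seq_cond; elim/big_ind: _.
- by rewrite dvdz1 absz_nat; case: p pp {px} => [|[|]].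
- by move=> u v; apply: ndvdzM.
- by move=> i; rewrite andbT; apply: px.
Qed.

Lemma logn_ndvdz (p : nat) (x : int) : prime p -> ~~ (p %| x)%Z -> logn p `|x| = 0%N.
Proof.
move=> pp px; have x0 : x != 0 by apply: contra px => /eqP ->; rewrite dvdz0.
by apply/eqP; rewrite -leqn0 leqNgt -(pfactor_dvdn 1) ?absz_gt0 // expn1.
Qed.

Section NotPower.
Variables (M : fieldExtType rat) (theta : M).
Hypothesis gen : <<1; theta>>%VS = fullv.

Let ev (P : {poly int}) : M := (map_poly intr P).[theta].

Let evM P Q : ev (P * Q) = ev P * ev Q.
Proof. by rewrite /ev rmorphM hornerM. Qed.
Let evB P Q : ev (P - Q) = ev P - ev Q.
Proof. by rewrite /ev rmorphB hornerD hornerN. Qed.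
Let evC c : ev c%:P = c%:~R.
Proof. by rewrite /ev map_polyC hornerC. Qed.
Let evX : ev 'X = theta.
Proof. by rewrite /ev map_polyX hornerX. Qed.
Let evXn P n : ev (P ^+ n) = ev P ^+ n.
Proof. by rewrite /ev rmorphXn horner_exp. Qed.
Let ev_prod (I : Type) (r : seq I) (P : I -> {poly int}) :
  ev (\prod_(i <- r) P i) = \prod_(i <- r) ev (P i).
Proof. by rewrite /ev rmorph_prod horner_prod. Qed.

Let evQ (P : {poly int}) : (map_poly (in_alg M) (map_poly intr P)).[theta] = ev P.
Proof.
rewrite /ev -map_poly_comp; congr (_.[_]); apply: eq_map_poly => z /=.
by rewrite -[in RHS](rmorph_int (in_alg M)).
Qed.

Let intr0 (z : int) : (z%:~R == 0 :> M) = (z == 0).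
Proof. by rewrite -(rmorph_int (in_alg M)) fmorph_eq0 intr_eq0. Qed.

Let ev_repr (y : M) : exists2 mC : int * {poly int}, mC.1 != 0 & mC.1%:~R * y = ev mC.2.
Proof.
have [p ->] := generator_poly gen y.
have [q [a a0 ->]] := rat_poly_scale p; exists (a, q) => //=.
rewrite linearZ /= hornerZ evQ mulr_algl -scalerAr mulrzl -scaler_int scalerA.
by rewrite mulVf ?scale1r // intr_eq0.
Qed.

(** [F] is the minimal polynomial of [theta] with denominators cleared. It need not be monic, so
    divisibility by [F] is stated up to a nonzero integer factor. *)
Let relation_poly : exists2 F : {poly int}, (1 < size F)%N & ev F = 0 /\
  forall W, ev W = 0 -> exists2 nQ : int * {poly int}, nQ.1 != 0 & nQ.1 *: W = nQ.2 * F.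
Proof.
have [m Dm m0] := minPoly1_poly theta.
have [F [a a0 DF]] := rat_poly_scale m.
have a0' : (a%:~R^-1 : rat) != 0 by rewrite invr_eq0 intr_eq0.
exists F; [|split].
- rewrite -size_rat_int_poly -(size_scale _ a0') -DF.
  rewrite -(size_map_poly (in_alg M)) Dm size_minPoly ltnS.
  by rewrite adjoin_degreeE dimv1 divn1 adim_gt0.
- apply: (mulfI (x := (a%:~R^-1)%:A)).
    by rewrite scaler_eq0 negb_or a0' oner_neq0.
  rewrite mulr0 -evQ; have := rootP (root_minPoly 1 theta).
  by rewrite -Dm DF linearZ hornerZ.
move=> W W0; have : minPoly 1 theta %| map_poly (in_alg M) (map_poly intr W).
  by apply: minPoly_dvdp; [apply/polyOver1P; eexists | rewrite /root evQ W0].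
rewrite -Dm dvdp_map DF dvdpZl // dvdp_rat_int => /Pdiv.Idomain.dvdpP[nQ n0 E].
by exists nQ.
Qed.

(* If [p] is a prime at which the minimal polynomial [F] of [theta] has a simple
   root, then [theta |-> a] embeds [M] in Q_p. Taking [t = a + p] mod [p ^ 2]
   makes [t - theta] a uniformiser and the other factors units. To avoid p-adic
   numbers, one evaluates at integers [a] with [F.[a]] divisible by a power of
   [p] chosen after the hypothetical [l]-th root. *)
Lemma not_power (xs : seq M) : theta \notin xs ->
  exists t : nat, forall (c : M -> nat) (l : nat) (y : M), (1 < l)%N ->
    (t%:R - theta) * \prod_(x <- xs) (t%:R - x) ^+ c x != y ^+ l.
Proof.
move=> xsN; have [F sF [F0 FP]] := relation_poly.
(* A polynomial not vanishing at [theta] is invertible modulo [F] over the rationals; clearing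
   denominators gives an integer [E] such that, for [p] not dividing [E], it vanishes at no root of
   [F] modulo [p]. *)
have unit P : ev P != 0 -> exists2 E : int, E != 0 & forall (p : nat) a, prime p ->
    ~~ (p %| E)%Z -> (p %| F.[a])%Z -> ~~ (p %| P.[a])%Z.
  move=> P0; have [[m V] /= m0 EV] := ev_repr (ev P)^-1.
  have [|[n Q] /= n0 E] := FP (V * P - m%:P).
    by rewrite evB evM evC -EV mulfVK // subrr.
  exists (n * m) => [|p a pp]; first by rewrite mulf_neq0.
  move=> pE Fa; apply: contra pE => Pa.
  have := congr1 (horner^~ a) E; rewrite !hornerE => En.
  have -> : n * m = n * V.[a] * P.[a] - Q.[a] * F.[a] by rewrite -En; ring.
  by rewrite rpredB // dvdz_mull.
have F'0 : ev F^`() != 0.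
  apply/negP => /eqP /FP[[n Q] /= n0 E].
  have F'n : F^`() != 0.
    have [j sj] : exists j, size F = j.+2 by case: (size F) sF => [|[|j]] // _; exists j.
    apply/eqP => /(congr1 (fun R : {poly int} => R`_j)).
    rewrite coef_deriv coef0 => /eqP; rewrite mulrn_eq0 /= => /eqP lF.
    by have := lead_coef_eq0 F; rewrite lead_coefE sj /= lF eqxx -size_poly_eq0 sj.
  have Q0 : Q != 0.
    apply: contraNneq F'n => Q0; move/eqP: E.
    by rewrite Q0 mul0r scale_poly_eq0 (negPf n0).
  have Fn : F != 0 by rewrite -size_poly_gt0 ltnW.
  have := lt_size_deriv Fn; rewrite -(size_scale _ n0) E size_mul //.
  rewrite -size_poly_gt0 in Q0; rewrite ltnNge => /negP; apply.
  by rewrite -(prednK Q0) addSn /= leq_addl.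
have [EF EF0 unitF] := unit _ F'0.
have [D D0 [H HE]] : exists2 D : M -> int, forall x, D x != 0 &
    exists H : M -> {poly int}, forall x, (D x)%:~R * x = ev (H x).
  exists (fun x => (projT1 (cid2 (ev_repr x))).1).
    by move=> x; case: cid2.
  by exists (fun x => (projT1 (cid2 (ev_repr x))).2) => x; case: cid2.
pose P x := (D x) *: 'X - H x.
have P0 x : x \in xs -> ev (P x) != 0.
  move=> xx; rewrite /P evB -mul_polyC evM evC evX -HE -mulrBr mulf_neq0 ?intr0 //.
  by rewrite subr_eq0; apply: contraNneq xsN => ->.
pose E x := if pselect (x \in xs) is left h then projT1 (cid2 (unit _ (P0 x h))) else 1.
have E0 x : E x != 0 by rewrite /E; case: pselect => // h; case: cid2.
have EP x (p : nat) a : x \in xs -> prime p ->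
    ~~ (p %| E x)%Z -> (p %| F.[a])%Z -> ~~ (p %| (P x).[a])%Z.
  by rewrite /E; case: pselect => // h _ pp; case: cid2 => /= e e0; apply.
have T0 : EF * \prod_(x <- xs) (E x * D x) != 0.
  rewrite mulf_neq0 //; elim/big_ind: _ => // [u v|x _]; exact: mulf_neq0.
have [p [a1 [pp pE Fa1]]] := prime_divisor_poly sF T0.
have [pEF pEx] : ~~ (p %| EF)%Z /\ forall x, x \in xs -> ~~ (p %| E x)%Z /\ ~~ (p %| D x)%Z.
  split; first by apply: contra pE => /dvdz_mulr.
  move=> x xx; apply/andP; rewrite -negb_or; apply: contra pE => h.
  rewrite (big_rem x) //= dvdz_mull // dvdz_mulr //.
  by case/orP: h => h; [rewrite dvdz_mulr|rewrite dvdz_mull].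
have pF'1 := unitF p a1 pp pEF Fa1.
have Fa1' : (p%:Z ^+ 1 %| F.[a1])%Z by rewrite expr1.
have [a2 Fa2 _] := hensel pp (ltn0Sn 0) Fa1' pF'1 1.
have p_p2 : (p%:Z %| p%:Z ^+ 2)%Z by rewrite expr2 dvdz_mulr.
have pF'2 := unitF p a2 pp pEF (dvdz_trans p_p2 Fa2).
pose t := `|((a2 + p%:Z) %% (p%:Z ^+ 2))%Z|%N.
have tE : (p%:Z ^+ 2 %| t%:Z - (a2 + p%:Z))%Z.
  have p20 : p%:Z ^+ 2 != 0 by rewrite expf_neq0 // -lt0n prime_gt0.
  rewrite /t gez0_abs ?modz_ge0 //; apply/dvdzP.
  exists (- ((a2 + p%:Z) %/ p%:Z ^+ 2)%Z).
  by rewrite [X in _ - X](divz_eq _ (p%:Z ^+ 2)); ring.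
exists t => c l y l1; apply/negP => /eqP Ey.
have [[m C] /= m0 EC] := ev_repr y.
pose U := \prod_(x <- xs) (((D x * t%:Z)%:P - H x) ^+ c x).
pose De := \prod_(x <- xs) D x ^+ c x.
have [|[n Q] /= n0 nQ] := FP ((t%:Z%:P - 'X) * (m ^+ l)%:P * U - De%:P * C ^+ l).
  rewrite evB !evM evB !evC evX evXn -EC exprMn -Ey ev_prod.
  have -> : \prod_(x <- xs) ev (((D x * t%:Z)%:P - H x) ^+ c x) =
      De%:~R * \prod_(x <- xs) (t%:R - x) ^+ c x.
    rewrite /De rmorph_prod -big_split; apply: eq_bigr => x _ /=.
    by rewrite evXn evB evC -HE rmorphXn -exprMn mulrBr intrM.
  by rewrite rmorphXn /=; ring.
(* The root of [F] is refined modulo [p ^ (2 + e)], beyond the valuation [e + 1] of the terms to be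
   compared. *)
pose e := logn p `|n * m ^+ l|.
have [a Fa aa2] := hensel pp (isT : 0 < 2)%N Fa2 pF'2 e.
have vta : logn p `|t%:Z - a| = 1%N.
  have <- : logn p `|p%:Z| = 1%N by rewrite absz_nat logn_prime // eqxx.
  apply: (@logn_absz_congr p 2) => //.
  - by rewrite -lt0n prime_gt0.
  - by rewrite absz_nat logn_prime // eqxx.
  have -> : p%:Z - (t%:Z - a) = (a - a2) - (t%:Z - (a2 + p%:Z)) by ring.
  exact: rpredB.
have pta : (p %| t%:Z - a)%Z.
  have -> : t%:Z - a = (t%:Z - (a2 + p%:Z)) - (a - a2) + p%:Z by ring.
  by apply: rpredD (rpredB (dvdz_trans p_p2 tE) (dvdz_trans p_p2 aa2)) (dvdzz _).
have pFa : (p %| F.[a])%Z by apply: dvdz_trans Fa; rewrite addSn exprS dvdz_mulr.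
have pU : ~~ (p %| U.[a])%Z.
  rewrite horner_prod ndvdz_prod // => x xx; rewrite horner_exp ndvdzX //.
  have := EP x p a xx pp (pEx x xx).1 pFa; apply: contra; rewrite /P !hornerE => h.
  have -> : D x * a - (H x).[a] = (D x * t%:Z - (H x).[a]) - D x * (t%:Z - a) by ring.
  by rewrite rpredB ?dvdz_mull.
have pDe : ~~ (p %| De)%Z.
  by rewrite ndvdz_prod // => x xx; rewrite ndvdzX // (pEx x xx).2.
have nz (z : int) : ~~ (p %| z)%Z -> z != 0.
  by apply: contra => /eqP ->; rewrite dvdz0.
have ta0 : t%:Z - a != 0.
  by apply/eqP => ta0; move: vta; rewrite ta0 logn0.
have lM (u v : int) : u != 0 -> v != 0 -> logn p `|u * v| = (logn p `|u| + logn p `|v|)%N.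
  by move=> u0 v0; rewrite abszM lognM ?absz_gt0.
have eE : e = (logn p `|n| + l * logn p `|m|)%N.
  by rewrite /e lM ?expf_neq0 // abszX lognX.
(* Beyond the denominators, the only valuation comes from the single factor [t - a]; the other side
   is an [l]-th power, which forces [l] to divide 1. *)
have vA : logn p `|n * ((t%:Z - a) * m ^+ l * U.[a])| = e.+1.
  rewrite !lM ?mulf_neq0 ?expf_neq0 ?(nz U.[a]) // vta (logn_ndvdz pp pU).
  by rewrite abszX lognX eE; lia.
have : logn p `|n * (De * C.[a] ^+ l)| = e.+1.
  rewrite -vA; apply: (@logn_absz_congr p (2 + e)) => //.
  - by rewrite !mulf_neq0 ?expf_neq0 ?(nz U.[a]).
  - by rewrite vA.
  have En := congr1 (horner^~ a) nQ; rewrite !hornerE /= in En.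
  by rewrite -mulrBr En dvdz_mull.
have [-> |C0] := eqVneq C.[a] 0; first by rewrite expr0n (gtn_eqF (ltnW l1)) !mulr0 logn0.
rewrite !lM ?mulf_neq0 ?expf_neq0 ?(nz De) // (logn_ndvdz pp pDe) abszX lognX eE.
move=> Euv; have {}Euv : (l * logn p `|C.[a]| = l * logn p `|m| + 1)%N.
  by apply/eqP; rewrite -(eqn_add2l (logn p `|n|)) addn1 addnS; move/eqP: Euv.
have := dvdn_mulr (logn p `|C.[a]|) (dvdnn l).
by rewrite Euv dvdn_addr ?dvdn_mulr // dvdn1 (gtn_eqF l1).
Qed.
End NotPower.

(** * Adding a cyclic layer *)

(** [theta] generates [M] over the rationals and not only over [k], since the arithmetic of
    [t - theta] is done with integer polynomials; an automorphism over [k] is then determined by its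
    value at [theta]. *)
Lemma base_primitive_element (k : fieldExtType rat) (M : splittingFieldType k) :
  exists2 theta : M, <<1; (theta : baseFieldType M)>>%VS = fullv
    & forall q : gal_of {:M}, q theta = theta -> q = 1%g.
Proof.
have [|theta gen] := primitive_element (L := baseFieldType M).
  by move=> p; rewrite pchar_lalg pchar_num.
exists theta => // q qt; apply/eqP/gal_eqP => x _; rewrite gal_id.
have [p ->] := generator_poly gen x; rewrite -horner_map /= qt.
rewrite -map_poly_comp; congr (_.[_]); apply: eq_map_poly => c /=.
rewrite -[c%:A]/(in_alg (baseFieldType M) c) fmorph_eq_rat.
exact: fmorph_rat.
Qed.

(** Conjugates of [a] over [E] are indexed by the whole Galois group, compatibly with right
    translation by Gal(M/E): [A q] is the image of [a] under the quotient of [q] by a representative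
    of its left coset. *)
Lemma gal_cocycle_root (k : fieldExtType rat) (M : splittingFieldType k)
    (E : {subfield M}) (a : M) :
  exists A : gal_of {:M} -> M,
    (forall q e, e \in 'Gal({:M} / E)%g -> e (A q) = A (q * e)%g) /\
    (forall q, exists2 e, e \in 'Gal({:M} / E)%g & A q = e a).
Proof.
set G := ('Gal({:M} / E))%G.
pose r (q : gal_of {:M}) := repr (q *: G)%g.
have rG q : ((r q)^-1 * q)%g \in G.
  have : r q \in (q *: G)%g by apply: (mem_repr q); apply: lcoset_refl.
  by rewrite mem_lcoset -groupV invMg invgK.
exists (fun q => ((r q)^-1 * q)%g a); split=> [q e eG|q]; last by exists ((r q)^-1 * q)%g.
have -> : r (q * e)%g = r q.
  by congr (repr _); rewrite lcosetM; congr (_ *: _)%g; apply: lcoset_id.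
by rewrite mulgA [in RHS]galM ?memvf.
Qed.

(** If the image of [H] in Z/N had index [m > 1], every [l h] would be divisible by [m], hence by a
    fixed prime divisor of [N]. *)
Lemma additive_hits_one (gT : finGroupType) (H : {group gT}) (N : nat) (l : gT -> nat) :
  (1 < N)%N ->
  {in H &, forall s t, (l (s * t)%g = l s + l t %[mod N])%N} ->
  (forall p, prime p -> (p %| N)%N -> exists2 h, h \in H & ~~ (p %| l h)%N) ->
  exists2 h, h \in H & (l h = 1 %[mod N])%N.
Proof.
move=> N1 lM lp; have N0 := ltnW N1.
pose f (s : gT) : 'Z_N := (l s)%:R.
have natE (m : nat) : nat_of_ord (m%:R : 'Z_N) = (m %% N)%N by rewrite val_Zp_nat.
have fM : {in H &, {morph f : s t / (s * t)%g}}.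
  move=> s t sH tH; rewrite /f -[LHS](Zp_nat_mod N1) lM // Zp_nat_mod //.
  exact: natrD.
pose F := Morphism fM.
have [full|] := eqVneq (F @* H)%g setT.
  have : (1%:R : 'Z_N) \in (F @* H)%g by rewrite full inE.
  case/morphimP => s _ sH E; exists s => //.
  have : nat_of_ord (1%:R : 'Z_N) = nat_of_ord ((l s)%:R : 'Z_N) := congr1 _ E.
  by rewrite !natE.
set G := (F @* H)%G => nf.
have Gdv : (#|G| %| N)%N.
  by have := cardSg (subsetT G); rewrite cardsT card_ord Zp_cast.
have Glt : (#|G| < N)%N.
  rewrite ltn_neqAle dvdn_leq // andbT; apply: contra nf => /eqP E.
  by rewrite eqEcard subsetT cardsT card_ord; apply: leq_trans (eq_leq (esym E)); rewrite Zp_cast.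
have [m NE] := dvdnP Gdv.
have m1 : (1 < m)%N.
  case: m NE => [|[|m]] // NE; first by have := leq_trans N0 (eq_leq NE).
  by have := leq_trans Glt (eq_leq NE); rewrite mul1n ltnn.
have mN : (pdiv m %| N)%N by apply: dvdn_trans (pdiv_dvd m) _; apply/dvdnP; exists #|G|; rewrite mulnC.
have [h hH /negP[]] := lp _ (pdiv_prime m1) mN.
have : (F h ^+ #|G|)%g = 1%g by apply: expg_cardG; rewrite mem_morphim.
have -> : (F h ^+ #|G|)%g = (l h * #|G|)%:R :> 'Z_N.
  transitivity (f h *+ #|G|); first exact: etrans (Zp_expg _ _) (esym (Zp_mulrn _ _)).
  by rewrite natrM mulr_natr.
move=> E0; have NG : nat_of_ord ((l h * #|G|)%:R : 'Z_N) = 0%N := congr1 _ E0.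
have : (m * #|G| %| l h * #|G|)%N.
  have NlG : (N %| l h * #|G|)%N by rewrite /dvdn -natE NG.
  by apply: dvdn_trans NlG; apply/dvdnP; exists 1%N; rewrite mul1n; exact: NE.
rewrite dvdn_pmul2r ?cardG_gt0 //; apply: dvdn_trans; exact: pdiv_dvd.
Qed.

(** The character [l] lives on the Galois group over [k], so that it cuts out an extension of [k];
    an element [sigma] fixing [K] with value 1 shows that the order remains [N] over [K]. One
    character serves all [z] in [zs]. *)
Lemma cyclic_layer (k : fieldExtType rat) (K : splittingFieldType k)
    (zs : seq K) (N : nat) : (1 < N)%N -> 0 \notin zs ->
  exists (L : splittingFieldType k) (i : 'AHom(K, L)) (l : gal_of {:L} -> nat),
  [/\ forall s t, (l (t * s)%g = l s + l t %[mod N])%N,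
      exists2 sigma, sigma \in 'Gal({:L} / limg i)%g & (l sigma = 1 %[mod N])%N
    & forall sigma z, sigma \in 'Gal({:L} / limg i)%g -> (l sigma = 1 %[mod N])%N ->
      z \in zs -> exists w : L, [/\ w != 0,
        forall s, s \in 'Gal({:L} / limg i)%g -> (N %| l s)%N -> s w = w
        & \prod_(j < N) (sigma ^+ j)%g w = i z]].
Proof.
move=> N1 zs0; have N0 := ltnW N1.
have [M [i1 [[zeta pz] roots]]] := radical_extension zs N0.
have [theta gen thetaP] := base_primitive_element M.
have thI : injective (fun q : gal_of {:M} => q theta).
  move=> q r E; apply/eqP; rewrite -(inj_eq (mulIg r^-1%g)) mulgV.
  by apply/eqP/thetaP; rewrite galM ?memvf // E -galM ?memvf // mulgV gal_id.
pose xs := [seq (q : gal_of {:M}) theta | q <- enum [set~ (1%g : gal_of {:M})]].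
have xsN : theta \notin xs.
  apply/mapP => [[q + E]]; rewrite mem_enum !inE => /eqP[].
  by apply/thetaP; rewrite -E.
have [t tP] := @not_power (baseFieldType M) theta gen xs xsN.
pose b (q : gal_of {:M}) : M := t%:R - q theta.
have prodb (c : gal_of {:M} -> nat) (e : nat) (y : M) : (1 < e)%N ->
    b 1%g * \prod_(q : gal_of {:M} | q != 1%g) b q ^+ c q != y ^+ e.
  move=> e1; pose c' (x : M) := if [pick q | (q : gal_of {:M}) theta == x] is Some q then c q else 0%N.
  have := tP c' e y e1; rewrite big_map big_enum /= /b gal_id.
  congr (_ * _ != _); apply: eq_big => [q|q _]; first by rewrite !inE.
  rewrite /c'; case: pickP => [r /eqP/thI -> //|/(_ q)]; by rewrite eqxx.
have b0 q : b q != 0.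
  (* Not being the square of 0, the product of all [b q] is nonzero. *)
  have := prodb (fun=> 1%N) 2 0 isT; rewrite expr0n mulf_eq0 negb_or.
  have [-> /andP[//]|q1] := eqVneq q 1%g.
  case/andP => _; rewrite (bigD1 q) //= expr1 mulf_eq0 negb_or; by case/andP.
have [L [i2 [_ rootsB]]] := radical_extension [seq b q | q : gal_of {:M}] N0.
pose i := (i2 \o i1)%AF; exists L, i.
have iE x : i x = i2 (i1 x) by rewrite /i /= lfunE.
have rho_ex (s : gal_of {:L}) : exists s0 : gal_of {:M}, forall x, s (i2 x) = i2 (s0 x).
  exact: gal_pullback.
pose rho s := projT1 (cid (rho_ex s)).
have rhoE (s : gal_of {:L}) x : s (i2 x) = i2 (rho s x) by rewrite /rho; case: cid.
have rhoM (s u : gal_of {:L}) : rho (s * u)%g = (rho s * rho u)%g.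
  apply/eqP/gal_eqP => x _; apply: (ahom_inj (i := i2)).
  by rewrite -rhoE !galM ?memvf // !rhoE.
have Bex q : exists B : L, B ^+ N = i2 (b q).
  by apply: rootsB; apply/imageP; exists q.
pose B q := projT1 (cid (Bex q)).
have BN q : B q ^+ N = i2 (b q) by rewrite /B; case: cid.
have B0 q : B q != 0.
  apply: contra_eq_neq (BN q) => ->.
  by rewrite expr0n (gtn_eqF N0) eq_sym fmorph_eq0.
(* The root of unity is conjugated along with [q], so that the relation [nM] between the exponents
   below carries no cyclotomic factor. *)
pose zt (q : gal_of {:M}) : L := i2 (q zeta).
have ztp q : N.-primitive_root (zt q) by rewrite /zt !fmorph_primitive_root.
have s_zt (s : gal_of {:L}) q : s (zt q) = zt (q * rho s)%g by rewrite /zt rhoE galM ?memvf.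
have s_b (s : gal_of {:L}) q : s (i2 (b q)) = i2 (b (q * rho s)%g).
  by rewrite rhoE /b rmorphB rmorph_nat galM ?memvf.
have nex (s : gal_of {:L}) q : exists n : 'I_N, s (B q) = zt (q * rho s)%g ^+ n * B (q * rho s)%g.
  have : (s (B q) / B (q * rho s)%g) ^+ N = 1.
    by rewrite expr_div_n -rmorphXn /= !BN s_b mulfV // fmorph_eq0.
  case/(prim_rootP (ztp (q * rho s)%g)) => n E; exists n.
  by rewrite -E mulfVK.
(* [sum_q n s q] is the transfer from [M] to [k] of the Kummer character of
   [theta |-> t - theta]. *)
pose n s q : nat := projT1 (cid (nex s q)).
have nE (s : gal_of {:L}) q : s (B q) = zt (q * rho s)%g ^+ n s q * B (q * rho s)%g.
  by rewrite /n; case: cid.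
have nN s q : (n s q < N)%N by rewrite /n; case: cid.
have nM s u q : (n u q + n s (q * rho u)%g = n (u * s)%g q %[mod N])%N.
  have := nE (u * s)%g q; rewrite galM ?memvf // nE rmorphM rmorphXn /= nE s_zt.
  rewrite rhoM !mulgA mulrA -exprD => /(mulIf (B0 _)).
  by move/eqP; rewrite (eq_prim_root_expr (ztp _)) => /eqP.
pose c s u q := ((n u q + n s (q * rho u)%g) %/ N)%N.
have cE s u q : (n u q + n s (q * rho u)%g = n (u * s)%g q + N * c s u q)%N.
  by rewrite [LHS](divn_eq _ N) nM (modn_small (nN _ _)) addnC mulnC.
pose l s := (\sum_(q : gal_of {:M}) n s q)%N; exists l.
have lM s u : (l s + l u = l (u * s)%g + N * \sum_(q : gal_of {:M}) c s u q)%N.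
  rewrite /l (reindex_inj (mulIg (rho u))) /= -big_split /=.
  by rewrite big_distrr -big_split /=; apply: eq_bigr => q _; rewrite -cE addnC.
have lM' s u : (l (u * s)%g = l s + l u %[mod N])%N by rewrite lM -[in RHS]modnDmr modnMr addn0.
split=> //; last first.
  move=> sigma z sG ls zz; have [a aN] := roots z zz.
  (* An [N]-th root of [z] is chosen for each index [q], so that Gal(M/K) permutes the roots exactly
     as the indices. *)
  have [A0 [A0e A0q]] := gal_cocycle_root (limg i1)%AS a.
  pose A q := i2 (A0 q).
  have rhoD s : s \in 'Gal({:L} / limg i)%g -> rho s \in 'Gal({:M} / limg i1)%g.
    move=> sD; rewrite gal_kHom ?subvf //; apply/kAHomP => _ /memv_imgP[x _ ->].
    apply: (ahom_inj (i := i2)); rewrite -rhoE -iE.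
    by rewrite (fixed_gal (subvf _) sD) // mem_limg_ahom.
  have AE (s : gal_of {:L}) q : s \in 'Gal({:L} / limg i)%g -> s (A q) = A (q * rho s)%g.
    by move=> sD; rewrite /A rhoE A0e ?rhoD.
  have AN q : A q ^+ N = i z.
    have [e eG Ae] := A0q q.
    rewrite /A -rmorphXn Ae -rmorphXn /= aN iE.
    by rewrite (fixed_gal (subvf _) eG) // mem_limg_ahom.
  have z0 : i z != 0 by rewrite fmorph_eq0; apply: contraNneq zs0 => <-.
  have A_0 q : A q != 0.
    by apply: contra_neq z0 => Aq0; rewrite -(AN q) Aq0 expr0n gtn_eqF.
  (* Since [z] is an [N]-th power in [M], its symbol with the transferred
     character is the corestriction of a trivial one, split by [V]. *)
  pose V s := \prod_(q : gal_of {:M}) A (q * rho s)%g ^+ n s q.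
  apply: (@cyclic_norm _ L ('Gal({:L} / limg i))%G N (i z) l V) => //.
  - by move=> s sD; rewrite (fixed_gal (subvf _) sD) // mem_limg_ahom.
  - by move=> s sD; apply/prodf_neq0 => q _; rewrite expf_neq0.
  move=> s u sD uD; exists (\sum_(q : gal_of {:M}) c s u q)%N; first exact: lM.
  rewrite /V (reindex_inj (mulIg (rho u))) /= rmorph_prod -big_split /=.
  rewrite -prodrXr -big_split /=; apply: eq_bigr => q _.
  rewrite rmorphXn /= AE // rhoM -!mulgA -exprD addnC cE exprD exprM AN.
  by [].
(* It suffices to test the character on the smaller group Gal(L/M), which fixes the indices and the
   roots of unity. *)
have [||h hH lh] := @additive_hits_one _ ('Gal({:L} / limg i2))%G N l N1.
- by move=> s u _ _; rewrite lM' addnC.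
- move=> p pp pN; apply: contrapT => H.
  have pl h : h \in 'Gal({:L} / limg i2)%g -> (p %| l h)%N.
    by move=> hH; apply: contrapT => /negP nph; apply: H; exists h.
  have rho1 h : h \in 'Gal({:L} / limg i2)%g -> rho h = 1%g.
    move=> hH; apply/eqP/gal_eqP => x _; apply: (ahom_inj (i := i2)).
    by rewrite gal_id -rhoE (fixed_gal (subvf _) hH) ?mem_limg_ahom.
  (* [zt 1] is a power of each [zt q]; raising [B q] to the corresponding power makes all exponents
     refer to one root of unity. *)
  have cex q : exists e, zt q ^+ e = zt 1%g.
    have /(prim_rootP (ztp q))[e E] := prim_expr_order (ztp 1%g).
    by exists e; rewrite -E.
  pose e q := projT1 (cid (cex q)).
  have eE q : zt q ^+ e q = zt 1%g by rewrite /e; case: cid.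
  have Np : N = (N %/ p * p)%N by rewrite divnK.
  (* If [p] divided the character on Gal(L/M), then [Om] would be a [p]-th root
     in [M] of a product of the [b q] in which [b 1] has exponent 1. *)
  pose Om := B 1%g ^+ (N %/ p) * \prod_(q : gal_of {:M} | q != 1%g) B q ^+ (e q * (N %/ p)).
  have hB h q m : h \in 'Gal({:L} / limg i2)%g ->
      h (B q ^+ m) = (zt q ^+ m) ^+ n h q * B q ^+ m.
    by move=> hH; rewrite rmorphXn /= nE rho1 // mulg1 exprMn exprAC.
  have Om_fix : Om \in limg i2.
    rewrite -(galois_fixedField (galois1f (limg i2)%AS)).
    apply/fixedFieldP; rewrite ?memvf // => h hH.
    rewrite /Om rmorphM rmorph_prod /= hB //.
    under eq_bigr => q _ do rewrite hB // exprM eE.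
    rewrite big_split /= mulrACA prodrXr -exprD.
    have <- : l h = (n h 1%g + \sum_(q | q != 1%g) n h q)%N by rewrite /l (bigD1 1%g).
    rewrite -exprM; have /dvdnP[m ->] := pl h hH.
    by rewrite mulnCA -Np mulnC exprM (prim_expr_order (ztp _)) expr1n mul1r.
  have /memv_imgP[y _ yE] := Om_fix.
  have /eqP[] := prodb e p y (prime_gt1 pp); apply: (ahom_inj (i := i2)).
  rewrite [RHS]rmorphXn /= -yE /Om exprMn -exprM -Np BN rmorphM rmorph_prod /=.
  congr (_ * _); rewrite -prodrXl; apply: eq_bigr => q _.
  by rewrite -exprM -mulnA -Np mulnC exprM BN rmorphXn.
exists h => //; apply: subsetP hH; apply: galS.
by apply/subvP => _ /memv_imgP[x _ ->]; rewrite iE mem_limg_ahom.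
Qed.

(** * Abelian extensions with prescribed norms *)

Section LayerGroup.
Variables (k : fieldExtType rat) (L : splittingFieldType k) (F : {subfield L}).
Variables (N : nat) (l : gal_of {:L} -> nat).
Hypotheses (N1 : (1 < N)%N) (nF : normalField 1 F).
Hypothesis lM : forall s t, (l (t * s)%g = l s + l t %[mod N])%N.
Variable sigma : gal_of {:L}.
Hypotheses (sD : sigma \in 'Gal({:L} / F)%g) (lsigma : (l sigma = 1 %[mod N])%N).

Let G := ('Gal({:L} / 1))%G.
Let D := ('Gal({:L} / F))%G.
Let f (s : gal_of {:L}) : 'Z_N := (l s)%:R.
Let c := normalField_cast (E := {:L}) F.
Let sFL : (1 <= F <= {:L})%VS.
Proof. by rewrite sub1v subvf. Qed.

Let fM s t : f (s * t)%g = (f s * f t)%g.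
Proof.
rewrite /f -[LHS](Zp_nat_mod N1) lM Zp_nat_mod //.
by rewrite addnC; exact: natrD.
Qed.

(** [E] below is the compositum of [F] with the extension cut out by the character: the kernel of
    [Phi] is the group of automorphisms trivial on both. *)
Let Phi s := (c s, f s).

Let PhiM : {in G &, {morph Phi : s t / (s * t)%g}}.
Proof.
move=> s t sG tG; rewrite /Phi fM; congr (_, _).
exact: (normalField_castM sFL nF).
Qed.

Let P := Morphism PhiM.
Let H := ('ker P)%G.
Let E := fixedField H.

Let f_inZp (a : 'Z_N) : f (sigma ^+ a)%g = a.
Proof.
have fX j : f (sigma ^+ j)%g = j%:R.
  elim: j => [|j IH]; last first.
    rewrite expgS fM IH mulrS; congr (_ * _)%g.
    by rewrite /f -(Zp_nat_mod N1) lsigma Zp_nat_mod.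
  have := fM 1%g 1%g; rewrite mulg1 => /esym/eqP.
  by rewrite -[X in _ == X]mulg1 (inj_eq (mulgI _)) => /eqP.
by rewrite fX natr_Zp.
Qed.

Let memH s : (s \in H) = (s \in D) && (N %| l s)%N.
Proof.
have sG : s \in G by apply: mem_gal1.
rewrite (sameP (kerP P sG) eqP) [P s == _]xpair_eqE; congr (_ && _).
  rewrite -[D : {set _}](normalField_ker sFL nF).
  by rewrite (sameP (kerP (normalField_cast_morphism sFL nF) sG) eqP).
rewrite -[_ == _](inj_eq val_inj) /= (val_Zp_nat N1) /dvdn; congr (_ == _).
Qed.

Let f_ker s : s \in H -> f s = 0.
Proof.
rewrite memH => /andP[_ Nl]; apply: val_inj.
by rewrite /= /f (val_Zp_nat N1); apply/eqP.
Qed.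

Lemma layer_fixed w : (forall s, s \in D -> (N %| l s)%N -> s w = w) -> w \in E.
Proof.
move=> wP; apply/fixedFieldP; rewrite ?memvf // => s.
by rewrite memH => /andP[]; apply: wP.
Qed.

Lemma layer_sub : (F <= E)%VS.
Proof.
apply/subvP => x xF; apply: layer_fixed => s sD' _.
by rewrite (fixed_gal (subvf _) sD').
Qed.

Lemma layer_galois : galois 1 E.
Proof. by apply: normal_fixedField_galois; [apply: galois1f|apply: ker_normal]. Qed.

Lemma layer_isog : ('Gal(E / 1) \isog setX 'Gal(F / 1) [set: 'Z_N])%g.
Proof.
have sE : (1 <= E <= {:L})%VS by rewrite sub1v subvf.
have nE : normalField 1 E by case/and3P: layer_galois.
have iso := normalField_isog (galois1f 1%AS) sE nE.
rewrite gal_fixedField in iso.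
rewrite isog_sym in iso; apply: isog_trans iso _.
have imP : (P @* G = setX 'Gal(F / 1) [set: 'Z_N])%g.
  apply/esym/setP => [[x a]]; rewrite in_setX inE andbT; apply/idP/morphimP.
    rewrite -(normalField_img (galois1f 1%AS) sFL nF) => /morphimP[s _ sG xE].
    (* A power of [sigma] corrects the second coordinate without changing the restriction to [F]. *)
    pose d := (sigma ^+ (a - f s)%R)%g.
    have dD : d \in D by rewrite groupX.
    have dG : d \in G by apply: subsetP dD; apply: galS; apply: sub1v.
    exists (s * d)%g; rewrite ?groupM //=.
    have Pd : P d = (1%g, a - f s).
      rewrite /P /= /Phi f_inZp; congr (_, _).
      have : d \in ('ker (normalField_cast_morphism sFL nF))%g by rewrite normalField_ker.
      exact: mker.
    rewrite PhiM // [Phi d]Pd /Phi -[c s]/(normalField_cast F s) -xE.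
    by congr (_, _); rewrite ?mulg1 // [RHS]addrC subrK.
  by case=> s _ sG [-> _]; rewrite mem_gal1.
by have := first_isog P; rewrite imP.
Qed.

(** The powers of [sigma] restrict to all of Gal(E/F): two elements of [D] agree on [E] exactly when
    the character takes the same value at them. *)
Lemma layer_norm w : w \in E -> galNorm F E w = \prod_(j < N) (sigma ^+ j)%g w.
Proof.
move=> wE.
have sE : (F <= E <= {:L})%VS by rewrite layer_sub subvf.
have nE : normalField F E by apply: normalFieldS (sub1v _) _; case/and3P: layer_galois.
pose cE := normalField_cast (E := {:L}) E.
have cEE s y : s \in D -> y \in E -> cE s y = s y.
  by move=> sD'; apply: (normalField_cast_eq sE nE).
have EH (a b : gal_of {:L}) : a \in D -> b \in D -> (cE a = cE b) <-> f a = f b.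
  move=> aD bD; have fab : f a = (f (a * b^-1)%g * f b)%g by rewrite -fM mulgKV.
  split=> [Eab|Eab].
    have abE : (a * b^-1)%g \in 'Gal({:L} / fixedField H)%g.
      rewrite gal_kHom ?subvf //; apply/kAHomP => y yE.
      by rewrite galM ?memvf // -(cEE a y aD yE) Eab (cEE b y bD yE) -galM ?memvf // mulgV gal_id.
    by rewrite gal_fixedField in abE; rewrite fab f_ker // [LHS]add0r.
  have abH : (a * b^-1)%g \in H.
    rewrite memH groupM ?groupV //=; move/eqP: fab.
    rewrite Eab -[X in X == _]mul1g (inj_eq (mulIg _)) eq_sym => /eqP /(congr1 val).
    by rewrite /= /f (val_Zp_nat N1) => /eqP.
  apply/eqP/gal_eqP => y yE; rewrite !cEE //.
  rewrite -[a in LHS](mulgKV b) galM ?memvf //; congr (b _).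
  by have /fixedFieldP := yE; rewrite memvf => /(_ isT); apply.
have XD j : (sigma ^+ j)%g \in D by rewrite groupX.
have -> : \prod_(j < N) (sigma ^+ j)%g w = \prod_(a : 'Z_N) cE (sigma ^+ a)%g w.
  transitivity (\prod_(j < N) cE (sigma ^+ j)%g w).
    by apply: eq_bigr => j _; rewrite cEE.
  by rewrite -!(big_mkord xpredT (fun j => cE (sigma ^+ j)%g w)) Zp_cast.
rewrite /galNorm -(big_imset (h := fun a : 'Z_N => cE (sigma ^+ a)%g) (fun x : gal_of E => x w)) /=; last first.
  by move=> a b _ _ /(EH _ _ (XD _) (XD _)); rewrite !f_inZp.
apply: eq_bigl => x; apply/idP/imsetP => [|[a _ ->]].
  rewrite -(normalField_img (galois1f F) sE nE) => /morphimP[s _ sD' ->].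
  by exists (f s) => //; apply/(EH _ _ sD' (XD _)); rewrite f_inZp.
rewrite gal_kHom ?layer_sub //; apply/kAHomP => y yF.
by rewrite cEE ?(subvP layer_sub) // (fixed_gal (subvf _) (XD _)).
Qed.
Lemma layer_subfield : exists E : {subfield L},
  [/\ galois 1 E, (F <= E)%VS, ('Gal(E / 1) \isog setX 'Gal(F / 1) [set: 'Z_N])%g,
      forall w, (forall s, s \in D -> (N %| l s)%N -> s w = w) -> w \in E
    & forall w, w \in E -> galNorm F E w = \prod_(j < N) (sigma ^+ j)%g w].
Proof.
exists E; split; [exact: layer_galois | exact: layer_sub | exact: layer_isog
  | exact: layer_fixed | exact: layer_norm].
Qed.
End LayerGroup.

Lemma normal_subfield_type (k : fieldType) (L : splittingFieldType k)
    (E : {subfield L}) : normalField 1 E ->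
  exists (S : splittingFieldType k) (j : 'AHom(S, L)), limg j = E.
Proof.
move=> /(splitting_normalField (sub1v E))[_ /polyOver1P[p ->] /subfield_type].
by case=> S [j [jE _]]; exists S, j.
Qed.

(** By transitivity, the norm of [w] down to [k] is the norm from [K] of [z a], hence [a]. Replacing
    the subfield of [L] by a field of its own lets the construction be iterated. *)
Lemma cyclic_layer_norms (k : fieldExtType rat) (K : splittingFieldType k)
    (gT : finGroupType) (G : {group gT}) (N : nat) (As : seq k) :
  (1 < N)%N -> 0 \notin As -> ('Gal({:K} / 1) \isog G)%g ->
  (forall a, a \in As -> exists z : K, galNorm 1 {:K} z = a%:A) ->
  exists K' : splittingFieldType k,
    ('Gal({:K'} / 1) \isog setX G [set: 'Z_N])%g /\
    (forall a, a \in As -> exists z : K', galNorm 1 {:K'} z = a%:A).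
Proof.
move=> N1 As0 isoG normK.
have [z zE] : exists z : k -> K, forall a, a \in As -> galNorm 1 {:K} (z a) = a%:A.
  exists (fun a => if pselect (a \in As) is left h then projT1 (cid (normK a h)) else 0).
  by move=> a aA; case: pselect => // h; case: cid.
have [|L [i [l [lM [sigma sD ls] norms]]]] := @cyclic_layer k K [seq z a | a <- As] N N1.
  apply/mapP => [[a aA za]]; have := zE a aA; rewrite -za galNorm0.
  by move/esym/eqP; rewrite scaler_eq0 oner_eq0 orbF => /eqP a0; rewrite a0 (negPf As0) in aA.
have [E [galE FE isoE fixE normE]] :=
  layer_subfield (F := limg i) N1 (normalField_limg i) lM sD ls.
have nE : normalField 1 E by case/and3P: galE.
have [S [j jE]] := normal_subfield_type nE.
have EE : E = aimg_aspace j {:S} by apply: val_inj.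
rewrite {}EE {E jE nE} in galE FE isoE fixE normE *; exists S; split.
  apply: isog_trans (gal_limg_isog j) _; apply: isog_trans isoE _.
  have isoF : ('Gal(limg i / 1) \isog G)%g.
    by apply: isog_trans isoG; rewrite isog_sym; exact: gal_limg_isog.
  have := setX_dprod 'Gal(limg i / 1)%G [set: 'Z_N]%G.
  move=> dp1; have := setX_dprod G [set: 'Z_N]%G => dp2.
  apply: (isog_dprod dp1 dp2).
    by apply: isog_trans (isog_trans isoF (isog_setX1 _ _)); rewrite isog_sym isog_setX1.
  by apply: isog_trans (isog_set1X _ _); rewrite isog_sym isog_set1X.
move=> a aA; have [w [w0 wfix wN]] := norms sigma _ sD ls (map_f z aA).
have wE := fixE w wfix; have /memv_imgP[w' _ ww'] := wE.
exists w'; apply: (ahom_inj (i := j)).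
rewrite galNorm_limg -ww' (rmorph_alg j).
have := @galNorm_tower _ L 1%AS (limg i)%AS (limg j)%AS w galE (normalField_limg i).
rewrite sub1v FE => /(_ isT wE) ->.
by rewrite normE // wN -galNorm_limg zE // (rmorph_alg i).
Qed.

(** Induction on the cyclic factors of [G], starting from [k] itself, where each element is its own
    norm. *)
Lemma prescribed_norms (k : fieldExtType rat) (As : seq k) (gT : finGroupType)
    (G : {group gT}) : 0 \notin As -> abelian G ->
  exists K : splittingFieldType k, ('Gal({:K} / 1) \isog G)%g /\
    (forall a, a \in As -> exists z : K, galNorm 1 {:K} z = a%:A).
Proof.
move=> As0 abG; have [b defG ordb] := abelian_structure abG.
have b1 x : x \in b -> (1 < #[x]%g)%N.
  move=> xb; have := abelian_type_gt1 G; rewrite -ordb => /allP/(_ _ (map_f _ xb)).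
  by [].
elim: b G defG b1 {abG ordb} => [|x b IH] G.
  rewrite big_nil => defG _; exists (k^o : splittingFieldType k).
  have G1 : 'Gal({:k^o} / 1)%g = 1%g.
    apply/trivgP/subsetP => s sG; rewrite inE; apply/gal_eqP => y _.
    rewrite gal_id (fixed_gal (subvf _) sG) //; apply/vlineP; exists y.
    by rewrite /GRing.scale /= mulr1.
  split; first by rewrite G1 -defG; apply: trivial_isog.
  move=> a _; exists a; rewrite /galNorm G1 big_set1 gal_id.
  by rewrite /GRing.scale /= mulr1.
rewrite big_cons => defG b1; have [[_ H _ defH] _ _ _] := dprodP defG.
rewrite defH in defG.
have [|K [isoK normK]] := IH H defH.
  by move=> y yb; apply: b1; rewrite inE yb orbT.
have x1 : (1 < #[x]%g)%N by apply: b1; rewrite mem_head.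
have [K' [isoK' normK']] := cyclic_layer_norms x1 As0 isoK normK.
exists K'; split=> //; apply: isog_trans isoK' _.
apply: (isog_dprod (setX_dprod H [set: 'Z_(#[x]%g)]%G)); first by rewrite dprodC; apply: defG.
  by rewrite isog_sym isog_setX1.
have -> : [set: 'Z_(#[x]%g)]%G = Zp_group #[x]%g by apply: val_inj; rewrite /= /Zp x1.
by apply: isog_trans (Zp_isog x); rewrite isog_sym isog_set1X.
Qed.

Local Open Scope classical_set_scope.

(** * Ultrametric absolute values detecting integrality *)

Definition is_subring (k : fieldType) (V : set k) : Prop :=
  [/\ V 1, forall x y, V x -> V y -> V (x - y) & forall x y, V x -> V y -> V (x * y)].

Section SubringTheory.
Variables (k : fieldType) (V : set k).
Hypothesis Vring : is_subring V.

Lemma subring1 : V 1. Proof. by case: Vring. Qed.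
Lemma subringB x y : V x -> V y -> V (x - y). Proof. by case: Vring => _ + _; apply. Qed.
Lemma subringM x y : V x -> V y -> V (x * y). Proof. by case: Vring => _ _; apply. Qed.
Lemma subring0 : V 0. Proof. by rewrite -(subrr 1); apply: subringB subring1 subring1. Qed.
Lemma subringN x : V x -> V (- x).
Proof. by move=> Vx; rewrite -sub0r; apply: subringB subring0 Vx. Qed.
Lemma subringD x y : V x -> V y -> V (x + y).
Proof. by move=> Vx Vy; rewrite -[y]opprK; apply/subringB/subringN. Qed.
Lemma subringX x n : V x -> V (x ^+ n).
Proof. by move=> Vx; elim: n => [|n IH]; [apply: subring1|rewrite exprS; apply: subringM]. Qed.
Lemma subring_sum (I : Type) (r : seq I) (P : pred I) (F : I -> k) :
  (forall i, P i -> V (F i)) -> V (\sum_(i <- r | P i) F i).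
Proof. by move=> VF; elim/big_ind: _ => //; [apply: subring0|apply: subringD]. Qed.
Lemma subring_nat n : V n%:R.
Proof. by elim: n => [|n IH]; [apply: subring0|rewrite -addn1 natrD; apply: subringD IH subring1]. Qed.
Lemma subring_int n : V n%:~R.
Proof.
case: n => n; first exact: subring_nat.
by rewrite NegzE rmorphN; apply/subringN/subring_nat.
Qed.
End SubringTheory.

Lemma subring_adjoin (k : fieldType) (V : set k) (x : k) : is_subring V ->
  is_subring [set u : k | exists2 p : {poly k}, (forall i, V p`_i) & u = p.[x]].
Proof.
move=> Vr; split.
- exists 1; last by rewrite hornerC.
  by move=> i; rewrite coef1; case: (i == 0)%N; [apply: subring1|apply: subring0].
- move=> _ _ [p Vp ->] [q Vq ->]; exists (p - q); last by rewrite hornerD hornerN.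
  by move=> i; rewrite coefB; apply: subringB.
- move=> _ _ [p Vp ->] [q Vq ->]; exists (p * q); last by rewrite hornerM.
  by move=> i; rewrite coefM; apply: subring_sum => // j _; apply: subringM.
Qed.

Lemma subring_int_adjoin (k : fieldType) (x : k) :
  is_subring [set u : k | exists p : {poly int}, u = (map_poly intr p).[x]].
Proof.
split; first by exists 1; rewrite rmorph1 hornerC.
- by move=> _ _ [p ->] [q ->]; exists (p - q); rewrite rmorphB hornerD hornerN.
- by move=> _ _ [p ->] [q ->]; exists (p * q); rewrite rmorphM hornerM.
Qed.

Definition int_integral (k : fieldType) (y : k) : Prop :=
  exists2 p : {poly int}, p \is monic & root (map_poly intr p) y.

(** Multiplying [y = p(1/y)] by a power of [y] gives a monic equation, with the coefficients of [p]
    reversed. *)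
Lemma int_integral_inv (k : fieldType) (y : k) (p : {poly int}) : y != 0 ->
  y = (map_poly intr p).[y^-1] -> int_integral y.
Proof.
move=> y0 yE; pose m := size p.
exists ('X^m - \poly_(i < m) p`_(m.-1 - i)).
  by rewrite monicE lead_coefDl ?lead_coefXn // size_polyN size_polyXn ltnS size_poly.
rewrite /root rmorphB /= map_polyXn hornerD hornerN hornerXn subr_eq0; apply/eqP.
have m0 : (0 < m)%N.
  rewrite lt0n; apply: contra_neq y0 => m0; rewrite yE; apply/eqP.
  by have := m0; move/eqP; rewrite size_poly_eq0 => /eqP ->; rewrite rmorph0 horner0.
rewrite -[in LHS](prednK m0) exprSr {2}yE.
have -> : (map_poly intr (\poly_(i < m) p`_(m.-1 - i)) : {poly k}) =
    \poly_(i < m) (p`_(m.-1 - i))%:~R.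
  by apply/polyP => i; rewrite coef_map !coef_poly; case: ifP.
rewrite horner_poly (@horner_coef_wide _ m) ?size_poly //.
rewrite (reindex_inj rev_ord_inj) /= mulr_sumr; apply: eq_bigr => i _.
have im : (i <= m.-1)%N by rewrite -ltnS prednK.
have -> : (m - i.+1)%N = (m.-1 - i)%N by rewrite subnS -subn1 subnAC subn1.
rewrite coef_map /= mulrCA; congr (_ * _).
have -> : y ^+ m.-1 = y ^+ i * y ^+ (m.-1 - i) by rewrite -exprD subnKC.
by rewrite exprVn mulfK // expf_neq0.
Qed.

(** As [y] is not integral, it is not in [Z[1/y]]; Zorn's lemma enlarges this ring to a maximal one
    that avoids [y]. *)
Lemma maximal_subring (k : fieldType) (y : k) : ~ int_integral y ->
  exists V : set k, [/\ is_subring V, V y^-1, ~ V y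
    & forall W, is_subring W -> (V `<=` W)%classic -> ~ W y -> (W `<=` V)%classic].
Proof.
move=> yN; have y0 : y != 0.
  apply/eqP => y0; apply: yN; exists 'X; first exact: monicX.
  by rewrite map_polyX rootX y0.
pose A0 : set k := [set u : k | exists p : {poly int}, u = (map_poly intr p).[y^-1]].
pose good (A : set k) := is_subring A /\ ~ A y.
have gA0 : good A0.
  split; first exact: subring_int_adjoin.
  by case=> p /(int_integral_inv y0).
(* Zorn is applied to [A `|` A0] so that the empty chain is bounded. *)
have [|A [gA Amax]] := @Zorn_bigcup k (fun A => good (A `|` A0)%classic).
  move=> F FP Ftot; set U := (X in (X `|` A0)%classic).
  have common u v : (U `|` A0)%classic u -> (U `|` A0)%classic v ->
      exists B, [/\ good B, B u, B v & (B `<=` U `|` A0)%classic].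
    have sub X : F X -> (X `|` A0 `<=` U `|` A0)%classic.
      by move=> FX x [Xx|]; [left; exists X|right].
    case=> [[X FX Xu]|Au] [[Y FY Yv]|Av].
    - case: (Ftot X Y FX FY) => XY.
        by exists (Y `|` A0)%classic; split; [exact: FP|left; apply: XY|left|exact: sub].
      by exists (X `|` A0)%classic; split; [exact: FP|left|left; apply: XY|exact: sub].
    - by exists (X `|` A0)%classic; split; [exact: FP|left|right|exact: sub].
    - by exists (Y `|` A0)%classic; split; [exact: FP|right|left|exact: sub].
    - by exists A0; split=> // x; right.
  split.
    split; first by right; case: gA0 => [[]].
      move=> u v /common H /H[B [[Br _] Bu Bv BU]].
      by apply: BU; apply: subringB.
    move=> u v /common H /H[B [[Br _] Bu Bv BU]].
    by apply: BU; apply: subringM.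
  by move=> yU; have [B [[_ By] + _ _]] := common y y yU yU.
exists (A `|` A0)%classic; have [Ar Ay] := gA; split=> //.
  by right; exists 'X; rewrite map_polyX hornerX.
move=> W Wr AW Wy.
apply: contrapT => nWA; apply: (Amax W).
  split; first by move=> x Ax; apply: AW; left.
  by move=> WA; apply: nWA => x /WA; left.
suff -> : (W `|` A0)%classic = W by [].
by apply/seteqP; split=> x; [case=> // xA; apply: AW; right|left].
Qed.

(** * A maximal subring avoiding an element is a valuation ring *)

Section MaximalSubring.
Variables (k : fieldType) (y : k) (V : set k).
Hypotheses (Vr : is_subring V) (Vy' : V y^-1) (Vy : ~ V y).
Hypothesis Vmax : forall W, is_subring W -> (V `<=` W)%classic -> ~ W y ->
  (W `<=` V)%classic.

Let y0 : y != 0.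
Proof. by apply: contra_notN Vy => /eqP ->; apply: subring0. Qed.

Let not_inv v : V v -> 1 != y^-1 * v.
Proof.
move=> Vv; apply: contra_notN Vy => /eqP E.
by have -> : y = v; rewrite // -[LHS]mulr1 E mulrA mulfV // mul1r.
Qed.

(** Inverting [e = 1 - v/y] cannot bring in [y]: one has [e ^ n = 1 - c/y] with [c] in [V], so
    [y * e ^ n] in [V] would make [1/y] a unit of [V]. By maximality [e] is already invertible in
    [V]. *)
Let one_sub_inv v : V v -> V (1 - y^-1 * v)^-1.
Proof.
move=> Vv; set e := 1 - _; have e0 : e != 0 by rewrite subr_eq0 not_inv.
have Ve : V e by apply: subringB (subring1 Vr) (subringM Vr _ _).
pose W : set k := [set u : k | exists n, V (u * e ^+ n)].
have eX u n m : (n <= m)%N -> V (u * e ^+ n) -> V (u * e ^+ m).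
  move=> nm Vu; rewrite -(subnKC nm) exprD mulrA.
  by apply: subringM (subringX _ _ _).
apply: (Vmax (W := W)) => [|x Vx||].
- split; first by exists 0%N; rewrite mulr1; apply: subring1.
    move=> u v' [n un] [m vm]; exists (maxn n m); rewrite mulrBl.
    by apply: subringB => //; [apply: (eX _ n)|apply: (eX _ m)]; rewrite ?leq_maxl ?leq_maxr.
  move=> u v' [n un] [m vm]; exists (n + m)%N; rewrite exprD mulrACA.
  exact: subringM.
- by exists 0%N; rewrite mulr1.
- case=> n Vn; have [c Vc Ec] : exists2 c, V c & e ^+ n = 1 - y^-1 * c.
    elim: n {Vn} => [|n [c Vc Ec]].
      by exists 0; [apply: subring0|rewrite mulr0 subr0].
    exists (c + v - y^-1 * c * v).
      apply: subringB => //; first exact: subringD.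
      by do 2!apply: subringM => //.
    by rewrite exprSr Ec /e; ring.
  have Vcn : V (c + y * e ^+ n) by apply: subringD.
  by have /eqP[] := not_inv Vcn; rewrite mulrDr mulrA mulVf // mul1r Ec; ring.
by exists 1%N; rewrite expr1 mulVf //; apply: subring1.
Qed.

(** [1/y] generates the unit ideal of [V[x]]; the degree bound [n] is the parameter of the descent
    below. *)
Let Rep n x := exists2 a : nat -> k, (forall i, V (a i)) &
  1 = y^-1 * \sum_(i < n.+1) a i * x ^+ i.

Let Rep_ex x : ~ V x -> exists n, Rep n x.
Proof.
move=> Vx.
pose W : set k := [set u : k | exists2 p : {poly k}, (forall i, V p`_i) & u = p.[x]].
have [p Vp yE] : W y.
  apply: contrapT => Wy; apply: Vx.
  apply: (Vmax (subring_adjoin x Vr) _ Wy).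
    move=> v Vv; exists v%:P; rewrite ?hornerC // => i; rewrite coefC.
    by case: ifP => // _; apply: subring0.
  exists 'X; rewrite ?hornerX // => i; rewrite coefX.
  by case: eqP => _; [apply: subring1|apply: subring0].
exists (size p), (fun i => p`_i) => //.
by rewrite -(@horner_coef_wide _ (size p).+1) -?yE ?mulVf.
Qed.

Let Rep_mono n m x : (n <= m)%N -> Rep n x -> Rep m x.
Proof.
move=> nm [a Va E]; exists (fun i => if (i < n.+1)%N then a i else 0).
  by move=> i; case: ifP => // _; apply: subring0.
rewrite E; congr (_ * _).
rewrite (big_ord_widen m.+1 (fun i => a i * x ^+ i)) //.
by rewrite big_mkcond /=; apply: eq_bigr => i _; case: ifP; rewrite ?mul0r.
Qed.

(** In the relation for [1/x], the coefficient [1 - b_0/y] is a unit, so [x ^ (n + 1)] is a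
    combination of lower powers; substituting this removes the leading term of the relation for
    [x]. *)
Let Rep_red n x : x != 0 -> Rep n.+1 x -> Rep n.+1 x^-1 -> Rep n x.
Proof.
move=> x0 [a Va Ea] [b Vb Eb]; set e := (1 - y^-1 * b 0%N)^-1.
have e0 : 1 - y^-1 * b 0%N != 0 by rewrite subr_eq0 not_inv.
have Ve : V e by apply: one_sub_inv.
exists (fun i => a i + y^-1 * a n.+1 * e * b (n.+1 - i)%N).
  move=> i; apply: subringD => //; do 3!apply: subringM => //.
have Eb' : 1 = e * y^-1 * \sum_(i < n.+1) b i.+1 * x^-1 ^+ i.+1.
  apply: (mulfI e0); rewrite mulr1 /e !mulrA mulfV // mul1r.
  rewrite {1}Eb big_ord_recl expr0 mulr1 mulrDr; ring.
have {}Eb' : x ^+ n.+1 = e * y^-1 * \sum_(i < n.+1) b (n.+1 - i)%N * x ^+ i.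
  rewrite -[LHS]mulr1 {1}Eb' mulrCA; congr (_ * _).
  rewrite (reindex_inj rev_ord_inj) mulr_sumr; apply: eq_bigr => i _ /=.
  have -> : (n.+1 - i.+1).+1 = (n.+1 - i)%N by rewrite subnSK.
  rewrite mulrCA; congr (_ * _).
  have -> : x ^+ n.+1 = x ^+ i * x ^+ (n.+1 - i) by rewrite -exprD subnKC // ltnW.
  by rewrite exprVn mulfK ?expf_neq0.
rewrite {1}Ea big_ord_recr /= Eb' mulrDr.
under [in RHS]eq_bigr => i _ do rewrite mulrDl.
rewrite big_split /= mulrDr; congr (_ + _ * _).
rewrite !mulr_sumr; apply: eq_bigr => i _; ring.
Qed.

(** Were [x] and [1/x] both outside [V], each would have a relation as in [Rep]; the longer is
    shortened by means of the other until degree 0, which contradicts [not_inv]. *)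
Lemma maximal_subring_valuation x : V x \/ V x^-1.
Proof.
have [->|x0] := eqVneq x 0; first by left; apply: subring0.
apply: contrapT => /not_orP[Vx Vx']; have [n xn] := Rep_ex Vx.
have [m xm] := Rep_ex Vx'.
have H : forall d n m u, (n + m < d)%N -> u != 0 -> (m <= n)%N -> Rep n u -> Rep m u^-1 -> False.
  elim=> [//|d IH] {x0 Vx Vx' xn xm}n {}m u nmd u0 mn un um.
  have um' := Rep_mono mn um.
  case: n => [|n] in nmd mn un um' *.
    have [a Va] := un; rewrite big_ord_recl big_ord0 addr0 expr0 mulr1 => E.
    by have := not_inv (Va 0%N); rewrite -E eqxx.
  have un' := Rep_red u0 un um'.
  have [mn'|nm'] := leqP m n; first by apply: (IH n m u).
  apply: (IH m n u^-1) => //; rewrite ?invr_eq0 ?invrK //; first by rewrite addnC.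
  exact: ltnW.
have [mn|nm] := leqP m n; first exact: (H (n + m).+1 n m x).
by apply: (H (m + n).+1 m n x^-1) => //; rewrite ?invr_eq0 ?invrK // ltnW.
Qed.
End MaximalSubring.

(** * The absolute value attached to a valuation ring *)

Section ValuationRing.
Variables (k : fieldExtType rat) (V : set k) (y : k).
Hypotheses (Vr : is_subring V) (Vtot : forall x, V x \/ V x^-1) (Vy : ~ V y).

Let U x := [/\ x != 0, V x & V x^-1].

Let U1 : U 1.
Proof. by rewrite /U invr1; split; rewrite ?oner_neq0 //; apply: subring1. Qed.

Let UM a b : U a -> U b -> U (a * b).
Proof.
case=> a0 Va Va' [b0 Vb Vb']; split; first exact: mulf_neq0.
  exact: subringM.
by rewrite invfM; apply: subringM.
Qed.

Let UV a : U a -> U a^-1.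
Proof. by case=> a0 Va Va'; split; rewrite ?invr_eq0 ?invrK. Qed.

Let UX a n : U a -> U (a ^+ n).
Proof. by move=> Ua; elim: n => [|n IH]; rewrite ?expr0 ?exprS //; apply: UM. Qed.

(** A valuation ring is local: either [c/(1 + c)] is in [V], and so is [1/(1 + c)], or its inverse
    is, which would make [c] a unit. *)
Let U_add1 c : V c -> ~ U c -> U (1 + c).
Proof.
move=> Vc nUc; have [-> |c0] := eqVneq c 0; first by rewrite addr0.
have e0 : 1 + c != 0.
  apply: contra_notN nUc; rewrite addrC addr_eq0 => /eqP ->.
  by split; rewrite ?oppr_eq0 ?oner_neq0 ?invrN ?invr1 //; apply: subringN (subring1 Vr).
have Ve : V (1 + c) by apply: subringD => //; apply: subring1.
split=> //; have [H|H] := Vtot (c / (1 + c)).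
  have -> : (1 + c)^-1 = 1 - c / (1 + c) by field.
  by apply: subringB => //; apply: subring1.
case: nUc; split=> //; have -> : c^-1 = (c / (1 + c))^-1 - 1 by field; rewrite ?c0 ?e0.
by apply: subringB => //; apply: subring1.
Qed.

(** When the terms have pairwise different values, one of them dominates and the sum has its
    value. *)
Let sum_nonequiv (I : eqType) (r : seq I) (F : I -> k) : uniq r ->
  (forall i, i \in r -> F i != 0) ->
  (forall i j, i \in r -> j \in r -> i != j -> ~ U (F i / F j)) ->
  r != [::] -> exists2 t, t \in r & U ((\sum_(i <- r) F i) / F t).
Proof.
elim: r => [//|a r IH] /= /andP[ar ur] F0 Fne _.
have Fa : F a != 0 by apply: F0; rewrite mem_head.
have [-> |rn] := eqVneq r [::].
  by exists a; rewrite ?mem_head // big_seq1 mulfV.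
have [||t tr Ut] := IH ur _ _ rn.
- by move=> i ir; apply: F0; rewrite inE ir orbT.
- by move=> i j ir jr; apply: Fne; rewrite inE ?ir ?jr orbT.
have Ft : F t != 0 by apply: F0; rewrite inE tr orbT.
rewrite big_cons; set S := \sum_(i <- r) F i in Ut *.
have S0 : S != 0 by case: Ut => + _ _; apply: contraNneq => ->; rewrite mul0r.
have at_ : a != t by apply: contraNneq ar => ->.
have nU : ~ U (F a / S).
  move=> UaS; apply: (Fne a t) => //; rewrite ?mem_head ?inE ?tr ?orbT //.
  have -> : F a / F t = (F a / S) * (S / F t) by field; rewrite ?S0 ?Ft.
  exact: UM.
have [H|H] := Vtot (F a / S).
  exists t; first by rewrite inE tr orbT.
  have -> : (F a + S) / F t = (1 + F a / S) * (S / F t) by field; rewrite ?S0 ?Ft.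
  by apply: UM => //; apply: U_add1.
exists a; rewrite ?mem_head //.
have -> : (F a + S) / F a = 1 + (F a / S)^-1 by field; rewrite ?S0 ?Fa.
by apply: U_add1 => // /UV; rewrite invrK.
Qed.

(** Otherwise [V] contains the rationals and [1/y], hence also [y], which is a rational polynomial
    in [1/y] because [k] is algebraic. *)
Let nonunit_nat : exists n : nat, (0 < n)%N && ~~ `[< V (n%:R)^-1 >].
Proof.
apply: contrapT => H; have Vn n : (0 < n)%N -> V (n%:R)^-1.
  move=> n0; apply: contrapT => nV; apply: H; exists n; rewrite n0 /=.
  exact/asboolPn.
have Vq (c : rat) : V c%:A.
  rewrite -[c]divq_num_den -[_%:A]/(in_alg k _) fmorph_div /= -!/(in_alg k _) !rmorph_int.
  apply: subringM => //; first exact: subring_int.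
  have := denq_gt0 c; case: (denq c) => // m m0; exact: Vn.
have [//|Vy'] := Vtot y; apply: Vy.
have : y \in <<1; y^-1>>%VS by rewrite -[y in y \in _]invrK rpredV memv_adjoin.
case/Fadjoin1_polyP => p ->; rewrite horner_coef.
apply: subring_sum => // i _; apply: subringM => //; last exact: subringX.
by rewrite coef_map; apply: Vq.
Qed.

(** The residue characteristic, found as the least positive integer not invertible in [V]. *)
Let p := ex_minn nonunit_nat.

Let p0 : (0 < p)%N.
Proof. by rewrite /p; case: ex_minnP => n /andP[]. Qed.

Let pnV : ~ V (p%:R)^-1.
Proof. by rewrite /p; case: ex_minnP => n /andP[_ /asboolPn]. Qed.

Let Vlt n : (0 < n < p)%N -> V (n%:R)^-1.
Proof.
rewrite /p; case: ex_minnP => m _ mmin /andP[n0 nm]; apply: contrapT => nV.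
by have := mmin n; rewrite n0 /= leqNgt nm => /(_ (introT (asboolPn _) nV)).
Qed.

Let natk0 n : (n%:R == 0 :> k) = (n == 0)%N.
Proof.
have k0 : has_char0 k by move=> q; rewrite pchar_lalg pchar_num.
exact: (pcharf0P k).1.
Qed.

Let pp : prime p.
Proof.
have p1 : (1 < p)%N.
  rewrite ltn_neqAle p0 andbT; apply/eqP => p1; apply: pnV.
  by rewrite -p1 invr1; apply: subring1.
have [lt|] := ltnP (pdiv p) p; last first.
  by move=> ge; have -> : p = pdiv p; [apply/eqP; rewrite eqn_leq ge pdiv_leq|apply: pdiv_prime].
case: pnV; rewrite -(divnK (pdiv_dvd p)) natrM invfM; apply: subringM => //.
  apply: Vlt; rewrite divn_gt0 ?pdiv_gt0 // pdiv_leq //=.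
  by rewrite ltn_Pdiv // prime_gt1 // pdiv_prime.
by apply: Vlt; rewrite pdiv_gt0.
Qed.

Let U_nat m : ~~ (p %| m)%N -> U m%:R.
Proof.
move=> pm; have m0 : (m%:R : k) != 0 by rewrite natk0; apply: contraNneq pm => ->.
have pk0 : (p%:R : k) != 0 by rewrite natk0 -lt0n.
split=> //; first exact: subring_nat.
have : coprimez m p by rewrite /coprimez /gcdz eqz_nat -/(coprime _ _) coprime_sym prime_coprime.
case/coprimezP => [[u v] /= uv].
have E : u%:~R * m%:R + v%:~R * p%:R = 1 :> k.
  by rewrite -!(rmorph_nat (intr : int -> k)) -!rmorphM -rmorphD /= !natz uv.
have [H|H] := Vtot (m%:R / p%:R).
  case: pnV; have -> : (p%:R)^-1 = u%:~R * (m%:R / p%:R) + v%:~R :> k.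
    by rewrite -[LHS]mul1r -[X in X * _ = _]E; field; rewrite ?pk0.
  by apply: subringD => //; [apply: subringM => //|]; apply: subring_int.
have -> : (m%:R)^-1 = u%:~R + v%:~R * (m%:R / p%:R)^-1 :> k.
  by rewrite -[LHS]mul1r -[X in X * _ = _]E; field; rewrite ?m0 ?pk0.
by apply: subringD => //; [|apply: subringM => //]; apply: subring_int.
Qed.

Let pk0 : (p%:R : k) != 0. Proof. by rewrite natk0 -lt0n. Qed.

Let U_rat (c : rat) : c != 0 -> exists s : int, U (c%:A / p%:R ^ s).
Proof.
have Un n : (0 < n)%N -> exists s : nat, U (n%:R / p%:R ^+ s).
  move=> n0; have [m pm nE] := pfactor_coprime pp n0.
  exists (logn p n); rewrite {1}nE natrM natrX mulfK ?expf_neq0 //.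
  by apply: U_nat; rewrite -prime_coprime.
move=> c0; have := denq_gt0 c; have := numq_eq0 c; rewrite (negPf c0).
move=> n0 d0; have [s Us] := Un `|numq c|%N (etrans (absz_gt0 _) (negbT n0)).
have [t Ut] := Un `|denq c|%N (etrans (absz_gt0 _) (negbT (gt_eqF d0))).
exists (s%:Z - t%:Z); have sgnU (z : int) q : U (`|z|%N%:R / q) -> U (z%:~R / q).
  case: (intP z) => [|n|n] //; rewrite abszN absz_nat rmorphN mulNr.
  case=> u0 Vu Vu'; split; rewrite ?oppr_eq0 ?invrN //; exact: subringN.
have {}Us := sgnU _ _ Us; have {}Ut := sgnU _ _ Ut.
have -> : c%:A = (numq c)%:~R / (denq c)%:~R :> k.
  by rewrite -[in LHS](divq_num_den c) -[_%:A]/(in_alg k _) fmorph_div /= -!/(in_alg k _) !rmorph_int.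
have d0' : ((denq c)%:~R : k) != 0.
  by rewrite -(rmorph_int (in_alg k)) fmorph_eq0 intr_eq0 gt_eqF.
rewrite expfzDr // -invr_expz -!exprnP invfM invrK.
have -> : (numq c)%:~R / (denq c)%:~R * ((p%:R ^+ s)^-1 * p%:R ^+ t) =
    ((numq c)%:~R / p%:R ^+ s) / ((denq c)%:~R / p%:R ^+ t) :> k.
  have ps := expf_neq0 s pk0; have pt := expf_neq0 t pk0.
  move: (p%:R ^+ s) (p%:R ^+ t) ps pt => a b a0 b0; field.
  by rewrite ?a0 ?b0 ?d0'.
by apply: UM Us (UV Ut).
Qed.

Let Vp_ge0 (s : int) : V (p%:R ^ s) -> 0 <= s.
Proof.
case: s => [//|n]; rewrite NegzE -invr_expz -exprnP => Vs; case: pnV.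
have -> : (p%:R)^-1 = (p%:R ^+ n.+1)^-1 * p%:R ^+ n :> k.
  by rewrite exprS invfM mulfVK // expf_neq0.
by apply: subringM => //; apply: subringX => //; apply: subring_nat.
Qed.

Let Up_eq0 (s : int) : U (p%:R ^ s) -> s = 0.
Proof.
case=> _ /Vp_ge0 s0; rewrite invr_expz => /Vp_ge0; rewrite oppr_ge0 => s0'.
by apply/eqP; rewrite eq_le s0 s0'.
Qed.

(* Two terms of a polynomial equation of degree at most [\dim {:k}] for [x] have
   the same value, so that the value of [x ^+ E] is a multiple of that of [p]. *)
Let E := (\dim {:k})`!%N.

Let val_ex (x : k) : x != 0 -> exists s : int, U (x ^+ E / p%:R ^ s).
Proof.
move=> x0; have [m Dm m0] := minPoly1_poly x.
pose r := [seq i <- iota 0 (size m) | m`_i != 0].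
pose F i := (m`_i)%:A * x ^+ i : k.
have Fr : \sum_(i <- r) F i = 0.
  have := rootP (root_minPoly 1 x); rewrite -Dm horner_coef size_map_poly.
  apply: etrans; have -> : r = [seq i <- index_iota 0 (size m) | m`_i != 0].
    by rewrite /index_iota subn0.
  rewrite big_filter big_mkord big_mkcond /=.
  apply: eq_bigr => i _; rewrite coef_map /F /=.
  by case: eqVneq => //= ->; rewrite scale0r mul0r.
have memr i : i \in r -> m`_i != 0 /\ (i < size m)%N.
  by rewrite mem_filter mem_iota add0n => /andP[-> /andP[_ ->]].
have F0 i : i \in r -> F i != 0.
  by case/memr=> mi _; rewrite mulf_neq0 ?expf_neq0 // scaler_eq0 negb_or mi oner_neq0.
have rn : r != [::].
  have : (size m).-1 \in r.
    by rewrite mem_filter -lead_coefE lead_coef_eq0 m0 mem_iota add0n prednK ?leqnn // size_poly_gt0.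
  by apply: contraTneq => ->.
have sm : (size m <= (\dim {:k}).+1)%N.
  rewrite -(size_map_poly (in_alg k)) Dm size_minPoly ltnS adjoin_degreeE dimv1 divn1.
  by apply: dimvS; apply: subvf.
(* If all terms had different values, their sum could not vanish. *)
have [i [j [ir jr ij Uij]]] : exists i j, [/\ i \in r, j \in r, (j < i)%N & U (F i / F j)].
  apply: contrapT => H; have ur : uniq r by rewrite filter_uniq ?iota_uniq.
  have [|t tr] := sum_nonequiv ur F0 _ rn.
    move=> i j ir jr; rewrite neq_ltn => /orP[ij|ij] Uij; apply: H.
      by exists j, i; split=> //; rewrite -[F j / F i]invrK invf_div; apply: UV.
    by exists i, j.
  by rewrite Fr mul0r => -[]; rewrite eqxx.
have [mi si] := memr i ir; have [mj sj] := memr j jr.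
have [s Us] := U_rat (mulf_neq0 mi (invr_neq0 mj)).
pose e := (i - j)%N; have e0 : (0 < e)%N by rewrite subn_gt0.
have eE : (e %| E)%N.
  apply: dvdn_fact; rewrite e0 -ltnS; apply: leq_trans sm.
  by apply: leq_ltn_trans si; apply: leq_subr.
have Ue : U (x ^+ e / p%:R ^ (- s)).
  have -> : x ^+ e / p%:R ^ (- s) = (F i / F j) / ((m`_i / m`_j)%:A / p%:R ^ s).
    rewrite /F -[(m`_i / m`_j)%:A]/(in_alg k _) fmorph_div /=.
    have -> : x ^+ i = x ^+ e * x ^+ j by rewrite -exprD subnK // ltnW.
    have A0 (c : rat) : c != 0 -> (c%:A : k) != 0.
      by move=> c0; rewrite scaler_eq0 negb_or c0 oner_neq0.
    have := A0 _ mi; have := A0 _ mj; have := expf_neq0 j x0; have := expfz_neq0 s pk0.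
    rewrite -invr_expz; move: (x ^+ e) (x ^+ j) (p%:R ^ s) (m`_i)%:A (m`_j)%:A.
    by move=> a b c d f c0 b0 f0 d0; field; rewrite ?b0 ?c0 ?d0 ?f0 ?oner_neq0.
  by apply: UM Uij (UV Us).
exists (- s * (E %/ e)%N); rewrite -exprz_exp -[_ ^ (E %/ e)%N]exprnP.
have -> : x ^+ E = (x ^+ e) ^+ (E %/ e) by rewrite -exprM mulnC divnK.
by rewrite -expr_div_n; apply: UX.
Qed.

(** This is [E] times the valuation normalised to 1 at [p]; its value at 0 is a default. *)
Let nu x : int := if pselect (x != 0) is left h then projT1 (cid (val_ex h)) else 0.

Let nuP x : x != 0 -> U (x ^+ E / p%:R ^ (nu x)).
Proof. by move=> x0; rewrite /nu; case: pselect => // h; case: cid. Qed.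

Let nuM x z : x != 0 -> z != 0 -> nu (x * z) = nu x + nu z.
Proof.
move=> x0 z0; have Ux := nuP x0; have Uz := nuP z0; have Uxz := nuP (mulf_neq0 x0 z0).
apply/eqP; rewrite -subr_eq0; apply/eqP/Up_eq0.
have -> : p%:R ^ (nu (x * z) - (nu x + nu z)) =
  (x ^+ E / p%:R ^ nu x) * (z ^+ E / p%:R ^ nu z) / ((x * z) ^+ E / p%:R ^ nu (x * z)) :> k.
  rewrite !expfzDr // -invr_expz expfzDr // exprMn.
  have := expf_neq0 E x0; have := expf_neq0 E z0.
  have := expfz_neq0 (nu x) pk0; have := expfz_neq0 (nu z) pk0; have := expfz_neq0 (nu (x * z)) pk0.
  move: (x ^+ E) (z ^+ E) (_ ^ nu (x * z)) (_ ^ nu x) (_ ^ nu z) => a b c d f c0 f0 d0 b0 a0.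
  by field; rewrite ?a0 ?b0 ?c0 ?d0 ?f0.
by apply: UM (UM Ux Uz) (UV Uxz).
Qed.

Let nu_ge0 x : x != 0 -> V x -> 0 <= nu x.
Proof.
move=> x0 Vx; apply: Vp_ge0; have [u0 _ Vu] := nuP x0.
have -> : p%:R ^ nu x = x ^+ E * (x ^+ E / p%:R ^ nu x)^-1.
  by rewrite invf_div mulrCA mulfV ?mulr1 // expf_neq0.
by apply: subringM => //; apply: subringX.
Qed.

Let nuV x : x != 0 -> nu x^-1 = - nu x.
Proof.
move=> x0; have := nuM x0 (invr_neq0 x0); rewrite mulfV // => H.
have n1 : nu 1 = 0.
  by have := nuM (oner_neq0 k) (oner_neq0 k); rewrite mulr1 => /eqP; rewrite -subr_eq0 opprD addNKr oppr_eq0 => /eqP.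
by apply/eqP; rewrite -addr_eq0 addrC -H n1.
Qed.

Lemma valuation_ring_abs (R : realType) : exists w : k -> R,
  [/\ absolute_value w, forall a b, w (a + b) <= Num.max (w a) (w b) & 1 < w y].
Proof.
have y0 : y != 0 by apply: contra_notN Vy => /eqP ->; apply: subring0.
have t0 : 2%:R != 0 :> R by rewrite pnatr_eq0.
pose w x : R := if x == 0 then 0 else 2%:R ^ (- nu x).
have w0 x : 0 <= w x by rewrite /w; case: ifP => // _; rewrite exprz_ge0 // ler0n.
have wM a b : w (a * b) = w a * w b.
  rewrite /w mulf_eq0; case: eqVneq => [|a0] /=; first by rewrite mul0r.
  case: eqVneq => [|b0] /=; first by rewrite mulr0.
  by rewrite nuM // opprD expfzDr.
have wle x z : (nu z <= nu x) -> x != 0 -> z != 0 -> w x <= w z.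
  by move=> h x0 z0; rewrite /w (negPf x0) (negPf z0) ler_eXz2l ?ltr1n // lerN2.
have wadd a b : w (a + b) <= Num.max (w a) (w b).
  have [-> |a0] := eqVneq a 0; first by rewrite add0r le_max lexx orbT.
  have [-> |b0] := eqVneq b 0; first by rewrite addr0 le_max lexx.
  have [-> |ab0] := eqVneq (a + b) 0; first by rewrite {1}/w eqxx le_max w0.
  have key u v : u != 0 -> v != 0 -> u + v != 0 -> V (u / v) -> w (u + v) <= w v.
    move=> u0 v0 uv0 Vuv; apply: wle => //.
    have : 0 <= nu ((u + v) / v).
      apply: nu_ge0; first by rewrite mulf_neq0 ?invr_neq0.
      by rewrite mulrDl mulfV //; apply: subringD => //; apply: subring1.
    by rewrite nuM ?invr_neq0 // nuV // subr_ge0.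
  have [H|H] := Vtot (a / b).
    by rewrite le_max key ?orbT.
  rewrite invf_div in H; rewrite addrC in ab0 *.
  by rewrite le_max (key b a b0 a0 ab0 H).
exists w; split=> //.
  split=> // [x|a b]; first rewrite /w.
    case: eqVneq => [->|x0] //; split=> // /eqP; last by rewrite (negPf x0).
    by rewrite (negPf (expfz_neq0 _ t0)).
  apply: le_trans (wadd a b) _; rewrite ge_max.
  by rewrite lerDl lerDr !w0.
rewrite /w (negPf y0) -[ltLHS](expr0z 2%:R) ltr_eXz2l ?ltr1n // oppr_gt0.
(* If [nu y] were nonnegative, [y ^+ E] would lie in [V]; then so would [y], even in the case where
   only [1/y] is known to. *)
rewrite ltNge; apply/negP => nu0; apply: Vy.
have VyE : V (y ^+ E).
  have [_ Vu _] := nuP y0; rewrite -[y ^+ E](mulfVK (expfz_neq0 (nu y) pk0)).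
  apply: subringM => //; case: (nu y) nu0 => // n _; rewrite -exprnP.
  by apply: subringX => //; apply: subring_nat.
have [//|Vy'] := Vtot y.
have -> : y = y ^+ E * y^-1 ^+ E.-1.
  have E0 : (0 < E)%N by apply: fact_gt0.
  by rewrite -(prednK E0) exprS exprVn mulfK // expf_neq0.
by apply: subringM => //; apply: subringX.
Qed.
End ValuationRing.

Lemma nonintegral_abs (R : realType) (k : fieldExtType rat) (y : k) :
  ~ int_integral y -> exists w : k -> R,
  [/\ absolute_value w, forall a b, w (a + b) <= Num.max (w a) (w b) & 1 < w y].
Proof.
move=> yN; have [V [Vr Vy' Vy Vmax]] := maximal_subring yN.
by apply: (valuation_ring_abs Vr (maximal_subring_valuation Vr Vy' Vy Vmax) Vy).
Qed.

(** * Places *)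

Definition ultrametric (R : realType) (k : fieldType) (w : k -> R) : Prop :=
  absolute_value w /\ forall a b, w (a + b) <= Num.max (w a) (w b).

Section AbsTheory.
Variables (R : realType) (k : fieldType) (w : k -> R).

Lemma abs0 : absolute_value w -> w 0 = 0.
Proof. by case=> _ w0 _ _; apply/w0. Qed.

Lemma abs_eq0 x : absolute_value w -> (w x == 0) = (x == 0).
Proof. by case=> _ w0 _ _; apply/eqP/eqP => /w0. Qed.

Lemma abs_gt0 x : absolute_value w -> (0 < w x) = (x != 0).
Proof. by move=> wa; rewrite lt0r abs_eq0 //; case: wa => -> _ _ _; rewrite andbT. Qed.

Lemma absM x y : absolute_value w -> w (x * y) = w x * w y.
Proof. by case=> _ _ + _; apply. Qed.

Lemma abs1 : absolute_value w -> w 1 = 1.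
Proof.
move=> wa; have w1 : w 1 != 0 by rewrite abs_eq0 // oner_neq0.
by apply: (mulIf w1); rewrite -absM // !mul1r.
Qed.

Lemma absX x n : absolute_value w -> w (x ^+ n) = w x ^+ n.
Proof. by move=> wa; elim: n => [|n IH]; rewrite ?expr0 ?abs1 // !exprS absM // IH. Qed.

Lemma absV x : absolute_value w -> w x^-1 = (w x)^-1.
Proof.
move=> wa; have [->|x0] := eqVneq x 0; first by rewrite !(invr0, abs0).
have wx : w x != 0 by rewrite abs_eq0.
by apply: (mulIf wx); rewrite -absM // !mulVf // abs1.
Qed.

Lemma absN x : absolute_value w -> w (- x) = w x.
Proof.
move=> wa; have : w (-1) ^+ 2 = 1 by rewrite -absX // sqrrN expr1n abs1.
have w0 : 0 <= w (-1) by case: wa.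
by move=> /eqP; rewrite sqrp_eq1 // => /eqP wN; rewrite -mulN1r absM // wN mul1r.
Qed.

Lemma ultrametric_sum (I : Type) (r : seq I) (P : pred I) (F : I -> k) (C : R) :
  ultrametric w -> 0 <= C -> (forall i, P i -> w (F i) <= C) ->
  w (\sum_(i <- r | P i) F i) <= C.
Proof.
case=> wa wu C0 FC; elim/big_ind: _ => //; first by rewrite abs0.
by move=> x y xC yC; apply: le_trans (wu _ _) _; rewrite ge_max xC.
Qed.

Lemma ultrametric_int (n : int) : ultrametric w -> w n%:~R <= 1.
Proof.
move=> wu; have wa := wu.1; have nat1 m : w m%:R <= 1.
  have -> : m%:R = \sum_(i < m) 1 :> k by rewrite sumr_const card_ord.
  by apply: ultrametric_sum => // i _; rewrite abs1.
by case: (intP n) => [|m|m]; rewrite ?rmorphN ?absN //; apply: nat1.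
Qed.

(** If [w x > 1], the leading term is strictly larger than all the others and cannot be
    cancelled. *)
Lemma ultrametric_root (p : {poly k}) (x : k) : ultrametric w ->
  w (lead_coef p) = 1 -> (forall i, w p`_i <= 1) -> root p x -> w x <= 1.
Proof.
move=> wu lp pC px; have wa := wu.1; rewrite leNgt; apply/negP => x1.
have p0 : p != 0 by rewrite -lead_coef_eq0 -(abs_eq0 _ wa) lp oner_neq0.
have sp : (0 < size p)%N by rewrite size_poly_gt0.
have := rootP px; rewrite horner_coef -(prednK sp) big_ord_recr /= => /eqP.
rewrite addrC addr_eq0 => /eqP /(congr1 w); rewrite absN //.
rewrite -lead_coefE absM // lp mul1r absX //.
case E : (size p).-1 => [|n].
  rewrite big_ord0 abs0 // expr0 => /eqP; by rewrite oner_eq0.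
move=> H; have : w x ^+ n.+1 <= w x ^+ n.
  rewrite H; apply: ultrametric_sum => //; first by rewrite exprn_ge0 // ltW // (lt_trans ltr01).
  move=> i _; rewrite absM // absX //; apply: le_trans (_ : w x ^+ i <= _).
    by rewrite ler_piMl // exprn_ge0 // ltW // (lt_trans ltr01).
  by rewrite ler_eXn2l // -ltnS ltn_ord.
by rewrite ler_eXn2l // ltnn.
Qed.
End AbsTheory.

(** If [w] is 1 on nonzero integers, it is so on nonzero rationals; then minimal polynomials bound
    [w] by 1 at [x] and at [1/x], so that [w] is trivial. *)
Lemma nontrivial_int (R : realType) (k : fieldExtType rat) (w : k -> R) :
  ultrametric w -> (exists2 x, x != 0 & w x != 1) ->
  exists m : nat, (0 < m)%N /\ w m%:R < 1.
Proof.
move=> wu [x x0 wx]; have wa := wu.1; apply: contrapT => H.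
have w1 n : (0 < n)%N -> w n%:R = 1.
  move=> n0; apply/eqP; rewrite eq_le (ultrametric_int n) // leNgt.
  by apply/negP => nlt; apply: H; exists n.
have wz (z : int) : z != 0 -> w z%:~R = 1.
  by case: (intP z) => [|n|n] // _; rewrite ?rmorphN ?absN //; apply: w1.
have wq (c : rat) : c != 0 -> w c%:A = 1.
  move=> c0; rewrite -[c]divq_num_den -[_%:A]/(in_alg k _) fmorph_div /= -!/(in_alg k _) !rmorph_int.
  by rewrite absM // absV // !wz ?invr1 ?mul1r ?numq_eq0 // gt_eqF.
have le1 u : w u <= 1.
  have [m Dm m0] := minPoly1_poly u.
  apply: (@ultrametric_root _ _ _ (minPoly 1 u)) => //; rewrite ?root_minPoly //.
    by rewrite (monicP (monic_minPoly _ _)) abs1.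
  move=> i; rewrite -Dm coef_map /=; have [->|c0] := eqVneq m`_i 0.
    by rewrite scale0r abs0.
  by rewrite wq.
move: wx; rewrite eq_le le1 /=; apply/negP; rewrite negbK.
have := le1 x^-1; rewrite absV // invf_le1 // abs_gt0 //.
Qed.

Section Places.
Variables (R : realType) (k : fieldExtType rat).
Implicit Type p : place R k.

Lemma place_abs p v : place_set p v -> absolute_value v.
Proof. by case: p => P [u _ PE] /=; rewrite PE => -[]. Qed.

Lemma place_nontrivial p v : place_set p v -> exists2 x, x != 0 & v x != 1.
Proof.
case: p => P [u [ua [x x0 ux]] PE] /=; rewrite PE => -[va [c c0 vE]].
exists x => //; rewrite vE powR_eq1 (negPf ux) (gt_eqF c0) orbF /=.
by rewrite ltNge; case: ua => -> _ _ _.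
Qed.

Lemma place_le1 p v w x : place_set p v -> place_set p w -> v x <= 1 -> w x <= 1.
Proof.
case: p => P [u [ua _] PE] /=; rewrite PE => -[va [a a0 vE]] [wa [b b0 wE]].
have u0 : 0 <= u x by case: ua.
rewrite vE wE => ux; have {}ux : u x <= 1.
  rewrite leNgt; apply/negP => u1; move: ux; rewrite leNgt => /negP; apply.
  have -> : 1 = 1 `^ a :> R by rewrite powR1.
  by rewrite gt0_ltr_powR ?nnegrE.
have -> : 1 = 1 `^ b :> R by rewrite powR1.
by rewrite ge0_ler_powR ?nnegrE ?(ltW b0).
Qed.

Lemma place_of_ultrametric (w : k -> R) : ultrametric w ->
  (exists2 x, x != 0 & w x != 1) ->
  exists2 p, nonarchimedean p & place_set p w.
Proof.
move=> [wa wu] nt.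
have ex : exists2 v, nontrivial_absolute_value v &
  [set u | absolute_value u /\ equiv_absolute_value w u] =
  [set u | absolute_value u /\ equiv_absolute_value v u] by exists w.
exists (Place ex) => /=; last first.
  by split=> //; exists 1 => // x; rewrite powRr1 //; case: wa.
move=> v [/= va [c c0 vE]] x y; rewrite !vE.
have w0 u : 0 <= w u by case: wa.
have mono a b : a <= b -> 0 <= a -> 0 <= b -> a `^ c <= b `^ c.
  by move=> ab a0 b0; apply: ge0_ler_powR; rewrite ?nnegrE ?(ltW c0).
have := wu x y; rewrite le_max => /orP[h|h]; rewrite le_max.
  by rewrite mono.
by rewrite (mono _ _ h) ?orbT.
Qed.

(** Powers of [m] will clear the denominators at the nonarchimedean places of [S]; [m] is a product
    of integers obtained one place at a time. *)
Lemma finite_place_reps (S : set (place R k)) : finite_set S ->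
  exists (n : nat) (v : 'I_n -> k -> R),
  (forall i, [/\ forall x y, v i (x * y) = v i x * v i y,
                 forall x, x != 0 -> 0 < v i x & v i 1 = 1]) /\
  exists2 m : nat, (0 < m)%N & forall p, S p -> nonarchimedean p ->
    exists2 i, place_set p (v i) & v i m%:R < 1.
Proof.
case=> n /card_set_bijP[f [fS finj _]].
pose Q (i : 'I_n) p := [/\ S p, nonarchimedean p & f p = i].
have rep_ex p : exists v, place_set p v.
  case: p => P [u [ua nt] PE] /=; exists u; rewrite PE; split=> //.
  by exists 1 => // x; rewrite powRr1 //; case: ua.
pose rep p := projT1 (cid (rep_ex p)).
have repP p : place_set p (rep p) by rewrite /rep; case: cid.
(* Indices of archimedean places carry the constant function 1, whose logarithm
   is harmless. *)
pose v (i : 'I_n) : k -> R :=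
  if pselect (exists p, Q i p) is left h then rep (projT1 (cid h)) else fun=> 1.
have vP i : (exists2 p, Q i p & v i = rep p) \/ v i = fun=> 1.
  rewrite /v; case: pselect => [h|]; last by right.
  by left; case: cid => p /= Qp; exists p.
have vS p : S p -> nonarchimedean p -> exists i : 'I_n, v i = rep p.
  move=> Sp np; have fp : (f p < n)%N by apply: fS.
  have Qp : Q (Ordinal fp) p by [].
  exists (Ordinal fp); rewrite /v; case: pselect => [h|[]]; last by exists p.
  case: cid => q /= [Sq _ fq]; congr rep; apply: finj => //; exact: mem_set.
have mul i : [/\ forall x y, v i (x * y) = v i x * v i y,
                 forall x, x != 0 -> 0 < v i x & v i 1 = 1].
  case: (vP i) => [[p _ ->]|->]; last by split=> // x y; rewrite mulr1.
  have ra := place_abs (repP p); split=> [x y|x|]; first exact: absM.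
    by rewrite abs_gt0.
  exact: abs1.
exists n, v; split=> //.
have rep_u p : nonarchimedean p -> ultrametric (rep p).
  by move=> np; split; [apply: place_abs (repP p)|apply: np].
have m_ex i : exists m : nat, (0 < m)%N /\
    (forall p, nonarchimedean p -> v i = rep p -> v i m%:R < 1).
  have [[p np vE]|H] := pselect (exists2 p, nonarchimedean p & v i = rep p).
    have [m [m0 mlt]] := nontrivial_int (rep_u p np) (place_nontrivial (repP p)).
    by exists m; split=> // q _ _; rewrite vE.
  by exists 1%N; split=> // p np vE; case: H; exists p.
pose m i := projT1 (cid (m_ex i)).
have mP i : (0 < m i)%N /\ (forall p, nonarchimedean p -> v i = rep p -> v i (m i)%:R < 1).
  by rewrite /m; case: cid.
exists (\prod_i m i)%N; first by rewrite prodn_gt0 // => i; case: (mP i).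
move=> p Sp np; have [i vi] := vS p Sp np; exists i; first by rewrite vi.
have [_ /(_ p np vi) lt1] := mP i.
rewrite (bigD1 i) //= natrM; have [-> _ _] := mul i.
apply: le_lt_trans lt1; rewrite ler_piMr //.
  by rewrite vi; case: (place_abs (repP p)).
by rewrite vi -[_%:R]/((_ : nat)%:Z%:~R); apply: ultrametric_int; apply: rep_u.
Qed.
End Places.

(** * Finiteness of S-units modulo powers *)

(** The modulus in a complex embedding, which sends a generator to a complex root of its minimal
    polynomial. *)
Lemma archimedean_abs (R : realType) (F : fieldExtType rat) :
  exists a : F -> R, absolute_value a /\ forall n : int, a n%:~R = `|n|%:~R.
Proof.
have F0 : has_char0 F by move=> p; rewrite pchar_lalg pchar_num.
have [x Dx] := primitive_element F0; have [m Dm m0] := minPoly1_poly x.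
have : size (map_poly (ratr : rat -> R[i]) m) != 1%N.
  rewrite size_map_poly -(size_map_poly (in_alg F)) Dm size_minPoly.
  by rewrite adjoin_degreeE dimv1 divn1 eqSS -lt0n adim_gt0.
case/closed_rootP => r mr.
have [e _ _] := embed_simple (phi := (ratr : {rmorphism rat -> R[i]})) Dx Dm mr.
exists (fun u => Normc.normc (e u)); split.
  split=> [u|u|u v|u v].
  - by case: (e u) => a b; apply: sqrtr_ge0.
  - split=> [/Normc.eq0_normc /eqP|->]; first by rewrite fmorph_eq0 => /eqP.
    by rewrite rmorph0 Normc.normc0.
  - by rewrite rmorphM Normc.normcM.
  - by rewrite rmorphD le_normcD.
move=> n; rewrite rmorph_int -(rmorph_int (real_complex R)) /=.
by rewrite expr0n addr0 sqrtr_sqr intr_norm.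
Qed.

Lemma poly_roots_list (k : fieldType) (p : {poly k}) : p != 0 ->
  exists s : seq k, forall x, root p x -> x \in s.
Proof.
have [n] := ubnP (size p); elim: n p => // n IHn p pn p0.
have [[x px]|H] := pselect (exists x, root p x); last first.
  by exists [::] => x px; case: H; exists x.
have /factor_theorem[q pE] := px.
have q0 : q != 0 by apply: contraNneq p0 => q0; rewrite pE q0 mul0r.
have [|//|s sP] := IHn q.
  by move: pn; rewrite pE size_mul ?polyXsubC_eq0 // size_XsubC addn2.
exists (x :: s) => z; rewrite pE rootM root_XsubC inE => /orP[/sP ->|->] //.
exact: orbT.
Qed.

Lemma int_integral_rmorph (A B : fieldType) (g : {rmorphism A -> B}) (u : A) :
  int_integral u -> int_integral (g u).
Proof.
case=> p mp pu; exists p => //.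
have -> : map_poly intr p = map_poly g (map_poly intr p).
  by rewrite -map_poly_comp; apply: eq_map_poly => z /=; rewrite rmorph_int.
by rewrite fmorph_root.
Qed.

Lemma prod_XsubC_int_integral (F : fieldType) (rs : seq F) :
  (forall r, r \in rs -> int_integral r) ->
  forall i, int_integral (\prod_(r <- rs) ('X - r%:P))`_i.
Proof.
elim: rs => [|r rs IH] Hr i.
  by rewrite big_nil coef1; exact: (integral_nat (intr : {rmorphism int -> F}) (i == 0)).
rewrite big_cons mulrBl coefB coefXM coefCM.
have Hrs := IH (fun z zr => Hr z (mem_behead (s := r :: rs) zr)).
apply: (@integral_sub _ _ (intr : {rmorphism int -> F})).
  by case: ifP => _; [exact: (integral0 (intr : {rmorphism int -> F}))|exact: Hrs].
apply: (@integral_mul _ _ (intr : {rmorphism int -> F})); last exact: Hrs.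
by apply: Hr; rewrite mem_head.
Qed.

Lemma prod_XsubC_abs (R : realType) (F : fieldType) (a : F -> R) (C : R) (rs : seq F) :
  absolute_value a -> 0 <= C -> (forall r, r \in rs -> a r <= C) ->
  forall i, a (\prod_(r <- rs) ('X - r%:P))`_i <= (1 + C) ^+ size rs.
Proof.
move=> aa C0; elim: rs => [|r rs IH] Hr i.
  by rewrite big_nil coef1 expr0; case: eqP => _; rewrite ?abs1 ?abs0.
rewrite big_cons mulrBl coefB coefXM coefCM exprS mulrDl mul1r.
have Hrs := IH (fun z zr => Hr z (mem_behead (s := r :: rs) zr)).
have a0 x : 0 <= a x by case: aa.
have aD x y : a (x + y) <= a x + a y by case: aa.
apply: le_trans (aD _ _) _; rewrite absN // absM // lerD //.
  by case: ifP => _ //; rewrite abs0 // exprn_ge0 // addr_ge0.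
by rewrite ler_pM // Hr // mem_head.
Qed.

Lemma rat_int_integral (F : fieldExtType rat) (q : rat) :
  int_integral (q%:A : F) -> exists z : int, q = z%:~R.
Proof.
case=> p mp pq.
have : root (map_poly intr p : {poly rat}) q.
  rewrite -(fmorph_root (in_alg F)) -map_poly_comp.
  by rewrite (eq_map_poly (g := intr)) // => z /=; rewrite -[RHS](rmorph_int (in_alg F)).
rewrite -(fmorph_root (ratr : {rmorphism rat -> algC})) -map_poly_comp => qr.
have : ratr q \in Aint.
  apply: root_monic_Aint qr _ _.
    by apply: monic_map.
  by apply/polyOverP => i; rewrite coef_map /= ratr_int.
move=> /(Cint_rat_Aint (Crat_rat q)) /intrP[z zE]; exists z.
by apply: (fmorph_inj (ratr : {rmorphism rat -> algC})); rewrite /= zE ratr_int.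
Qed.

(** The product of the [X - h (j x)] over the Galois group has integer coefficients, bounded in
    terms of [C] and the order of the group. There are finitely many such polynomials, each with
    finitely many roots. *)
Lemma bounded_integral_finite (R : realType) (k : fieldType) (F : splittingFieldType rat)
    (j : {rmorphism k -> F}) (a : F -> R) (C : R) :
  absolute_value a -> (forall n : int, a n%:~R = `|n|%:~R) ->
  exists s : seq k, forall x, int_integral x ->
    (forall h : gal_of {:F}, a (h (j x)) <= C) -> x \in s.
Proof.
move=> aa aint; pose d := #|{: gal_of {:F}}|.
have [B BC] : exists B : nat, (1 + `|C|) ^+ d <= B%:R.
  exists (Num.bound ((1 + `|C|) ^+ d)).
  by rewrite ltW // archi_boundP // exprn_ge0 // addr_ge0.
(* The shift by [B] encodes the integers from [-B] to [B] in a finite type. *)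
pose pol (f : {ffun 'I_d.+1 -> 'I_(B + B).+1}) : {poly int} :=
  \poly_(i < d.+1) ((f (inord i))%:Z - B%:Z).
have list f : exists s : seq k, map_poly intr (pol f) != 0 :> {poly k} ->
    forall x, root (map_poly intr (pol f)) x -> x \in s.
  have [/poly_roots_list[s sP]|] := boolP (map_poly intr (pol f) != 0 :> {poly k}).
    by exists s.
  by exists [::].
pose ls f := projT1 (cid (list f)).
exists (flatten [seq ls f | f : {ffun 'I_d.+1 -> 'I_(B + B).+1}]) => x xint xC.
pose rs := [seq (h : gal_of {:F}) (j x) | h : gal_of {:F}].
pose P := \prod_(r <- rs) ('X - r%:P).
have Pint i : int_integral P`_i.
  apply: prod_XsubC_int_integral => r /mapP[h _ ->].
  by apply: int_integral_rmorph; apply: int_integral_rmorph.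
have Pa i : a P`_i <= B%:R.
  apply: le_trans BC; have -> : d = size rs by rewrite size_image.
  apply: prod_XsubC_abs => // r /mapP[h _ ->].
  exact: le_trans (xC h) (ler_norm _).
have Pfix i : P`_i \in 1%VS.
  have galF : galois 1 {:F}.
    rewrite /galois sub1v normalFieldf andbT; apply/separableP => y _.
    by apply: pcharf0_separable => p; rewrite pchar_lalg pchar_num.
  rewrite -(galois_fixedField galF); apply/fixedFieldP; rewrite ?memvf // => t _.
  rewrite -coef_map /=; suff -> : map_poly t P = P by [].
  rewrite /P /rs big_image rmorph_prod /= [RHS](reindex_inj (mulIg t)) /=.
  apply: eq_bigr => h _.
  by rewrite rmorphB /= map_polyX map_polyC /= galM ?memvf.
have Pz i : exists z : int, P`_i = z%:~R.
  have /vlineP[q qE] := Pfix i; have := Pint i; rewrite qE => /rat_int_integral[z ->].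
  by exists z; rewrite -(rmorph_int (in_alg F)).
pose z i := projT1 (cid (Pz i)); have zE i : P`_i = (z i)%:~R by rewrite /z; case: cid.
have zB i : `|z i| <= B%:Z.
  by have := Pa i; rewrite zE aint -[B%:R]/(B%:Z%:~R) ler_int.
pose f := [ffun i : 'I_d.+1 => inord (absz (z i + B%:Z)) : 'I_(B + B).+1].
have fE (i : 'I_d.+1) : (f i)%:Z - B%:Z = z i.
  have := zB i; rewrite ler_norml => /andP[z1 z2].
  have zp : 0 <= z i + B%:Z by rewrite -lerBlDr sub0r.
  rewrite ffunE inordK ?gez0_abs ?addrK // ltnS -lez_nat gez0_abs //.
  by rewrite PoszD lerD2r.
have PE : P = map_poly intr (pol f).
  apply/polyP => i; rewrite coef_map coef_poly; case: ltnP => id.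
    have -> : inord i = Ordinal id by apply: val_inj; rewrite /= inordK.
    by rewrite fE zE.
  rewrite nth_default // /P size_prod_XsubC size_image; exact: id.
have rx : root (map_poly intr (pol f)) x.
  rewrite -(fmorph_root j) -map_poly_comp.
  rewrite (eq_map_poly (g := intr)) => [|u /=]; last by rewrite rmorph_int.
  rewrite -PE root_prod_XsubC; apply/mapP.
  by exists 1%g; rewrite ?mem_enum ?gal_id.
apply/flattenP; exists (ls f); first by apply/mapP; exists f; rewrite ?mem_enum.
rewrite /ls; case: cid => s /= sP; apply: sP => //.
rewrite -(map_poly_eq0 j) -map_poly_comp (eq_map_poly (g := intr)) => [|u /=]; last by rewrite rmorph_int.
by rewrite -PE monic_neq0 // monic_prod_XsubC.
Qed.

(** A finite family from [U] of maximal rank spans, since adjoining another [u] cannot raise the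
    rank. *)
Lemma spanning_rows (F : fieldType) (T : Type) (m : nat) (U : set T) (f : T -> 'rV[F]_m) :
  exists (r : nat) (us : 'I_r -> T), (forall i, U (us i)) /\
    forall u, U u -> (f u <= \matrix_(i < r) f (us i))%MS.
Proof.
pose P (d : nat) := `[< exists (r : nat) (us : 'I_r -> T), (forall i, U (us i)) /\
  \rank (\matrix_(i < r) f (us i)) = d >].
have exP : exists d, P d.
  have us : 'I_0 -> T by case.
  exists (\rank (\matrix_(i < 0) f (us i))); apply/asboolP; exists 0%N, us.
  by split=> // -[].
have ubP d : P d -> (d <= m)%N by move=> /asboolP[r [us [_ <-]]]; apply: rank_leq_col.
case: (ex_maxnP exP ubP) => d /asboolP[r [us [Uus rk]]] dmax.
exists r, us; split=> // u Uu; set A := \matrix_(i < r) f (us i) in rk *.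
pose us' (i : 'I_r.+1) := if unlift ord0 i is Some j then us j else u.
pose A' := \matrix_(i < r.+1) f (us' i).
have AA' : (A <= A')%MS.
  apply/row_subP => i; have -> : row i A = row (lift ord0 i) A'.
    by rewrite !rowK /us' liftK.
  exact: row_sub.
have : P (\rank A').
  apply/asboolP; exists r.+1, us'; split=> // i; rewrite /us'.
  by case: unlift.
move/dmax; rewrite -rk => le; have := mxrank_leqif_sup AA'.
case=> le' ; rewrite eqn_leq le' le => /esym A'A.
apply: submx_trans A'A; have -> : f u = row ord0 A' by rewrite rowK /us' unlift_none.
exact: row_sub.
Qed.

(** In logarithmic coordinates [u] is a real combination of a finite family, with coefficients
    [c_i]. Dividing by the [n]-th power of the product with the floors of [c_i / n] as exponents
    leaves coefficients between 0 and [n], hence bounded coordinates. *)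
Lemma discrete_classes (R : realType) (k : fieldType) (I : finType)
    (U : set k) (L : I -> k -> R) (n : nat) :
  (0 < n)%N -> U 1 -> (forall x, U x -> x != 0) ->
  (forall x y, U x -> U y -> U (x * y)) -> (forall x, U x -> U x^-1) ->
  (forall i x y, U x -> U y -> L i (x * y) = L i x + L i y) ->
  (forall B : R, exists s : seq k, forall x, U x -> (forall i, L i x <= B) -> x \in s) ->
  exists As : seq k, 0 \notin As /\
    forall u, U u -> exists2 a, a \in As & exists2 v, v != 0 & u = a * v ^+ n.
Proof.
move=> n0 U1 U0 UM UV LM fin.
have L1 i : L i 1 = 0.
  by apply/(addrI (L i 1)); rewrite addr0 -(LM i _ _ U1 U1) mulr1.
have LV i x : U x -> L i x^-1 = - L i x.
  by move=> Ux; apply/(addrI (L i x)); rewrite -(LM i _ _ Ux (UV _ Ux)) (mulfV (U0 _ Ux)) subrr.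
have UX x e : U x -> U (x ^+ e).
  by move=> Ux; elim: e => [|e IH]; rewrite ?expr0 // exprS; apply: UM.
have LX i x e : U x -> L i (x ^+ e) = e%:R * L i x.
  move=> Ux; elim: e => [|e IH]; first by rewrite expr0 L1 mul0r.
  by rewrite exprS (LM i _ _ Ux (UX _ _ Ux)) IH -natr1 mulrDl mul1r addrC.
have UZ x (e : int) : U x -> U (x ^ e).
  move=> Ux; case: e => e; first exact: UX.
  by rewrite NegzE -invr_expz -exprnP; apply/UV/UX.
have LZ i x (e : int) : U x -> L i (x ^ e) = e%:~R * L i x.
  move=> Ux; case: e => e; first exact: LX.
  by rewrite NegzE -invr_expz -exprnP (LV i _ (UX _ _ Ux)) (LX i _ _ Ux) rmorphN mulNr.
have Uprod (r : nat) (us : 'I_r -> k) : (forall i, U (us i)) -> U (\prod_i us i).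
  by move=> Uus; elim/big_ind: _.
have Lprod i (r : nat) (us : 'I_r -> k) : (forall j, U (us j)) ->
    L i (\prod_j us j) = \sum_j L i (us j).
  elim: r us => [|r IH] us Uus; first by rewrite !big_ord0 L1.
  by rewrite !big_ord_recr LM ?IH //=; apply: Uprod.
have [r [us [Uus span]]] := spanning_rows U (fun x => \row_(j < #|I|) L (enum_val j) x).
pose B : R := n%:R * \sum_(i < r) \sum_(j : I) `|L j (us i)|.
have [s sP] := fin B.
exists [seq x <- s | x != 0]; split; first by rewrite mem_filter eqxx.
move=> u Uu; have /mulmxKpV := span u Uu.
set A := \matrix_(i < r) _; set c := _ *m pinvmx _ => cA.
have Lc j : L j u = \sum_(i < r) c 0 i * L j (us i).
  have := congr1 (fun M : 'rV_#|I| => M 0 (enum_rank j)) cA; rewrite !mxE enum_rankK => <-.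
  by apply: eq_bigr => i _; rewrite !mxE enum_rankK.
pose e i := Num.floor (c 0 i / n%:R).
pose v := \prod_(i < r) us i ^ e i.
have Uv : U v by apply: Uprod => i; apply: UZ.
have v0 : v != 0 by apply: U0.
have Ua : U (u * (v ^+ n)^-1) by apply: UM => //; apply/UV/UX.
have nR : 0 < n%:R :> R by rewrite ltr0n.
exists (u * (v ^+ n)^-1); last first.
  by exists v => //; rewrite mulfVK // expf_neq0.
rewrite mem_filter (U0 _ Ua) /=; apply: sP => // j.
rewrite LM //; last by apply/UV/UX.
rewrite (LV j _ (UX _ n Uv)) (LX j _ n Uv) Lprod; last by move=> i; apply: UZ.
rewrite Lc mulr_sumr -sumrB /B mulr_sumr; apply: ler_sum => i _.
rewrite LZ // mulrA -mulrBl.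
apply: le_trans (ler_norm _) _; rewrite normrM; apply: ler_pM => //.
  have /andP[f1 f2] := floor_itv (c 0 i / n%:R); rewrite -/(e i) in f1 f2.
  rewrite ler_pdivlMr // in f1; rewrite ltr_pdivrMr // in f2.
  rewrite ger0_norm ?subr_ge0 1?mulrC // lerBlDl.
  by rewrite ltW //; move: f2; rewrite rmorphD mulrDl /= mul1r.
by rewrite (bigD1 j) //= lerDl sumr_ge0.
Qed.

(** The coordinates are logarithms at the nonarchimedean places of [S] and of all conjugates. Where
    they are bounded above, [M * u] is integral with bounded conjugates for a fixed integer [M],
    which leaves finitely many [u]. *)
Lemma S_unit_classes (R : realType) (k : fieldExtType rat) (S : set (place R k))
    (n : nat) : finite_set S -> (0 < n)%N ->
  exists As : seq k, 0 \notin As /\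
    forall u, S_unit S u -> exists2 a, a \in As & exists2 v, v != 0 & u = a * v ^+ n.
Proof.
move=> finS n0.
have [r [v [vP [m m0 vm]]]] := finite_place_reps finS.
have k0 : has_char0 k by move=> p; rewrite pchar_lalg pchar_num.
have [x Dx] := primitive_element k0; have [mp Dm mp0] := minPoly1_poly x.
have [F [rs Dp _]] := splitting_field mp0.
have [|y my] := dvdp_split_root Dp (dvdpp _).
  rewrite size_map_poly -(size_map_poly (in_alg k)) Dm size_minPoly ltnS.
  by rewrite adjoin_degreeE dimv1 divn1 adim_gt0.
have [j _ _] := embed_simple Dx Dm my.
have [a [aa aint]] := archimedean_abs R F.
have a_gt0 (h : gal_of {:F}) u : u != 0 -> 0 < a (h (j u)).
  by move=> u0; rewrite abs_gt0 // !fmorph_eq0.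
have Sabs (p : place R k) w u : place_set p w -> u != 0 -> 0 < w u.
  by move=> pw u0; rewrite (abs_gt0 _ (place_abs pw)).
apply: (@discrete_classes R k ('I_r + gal_of {:F})%type (S_unit S)
  (fun i u => match i with inl i => ln (v i u) | inr h => ln (a (h (j u))) end)) => //.
- split; first exact: oner_neq0.
  by move=> p _ _ w pw; rewrite /valuation (abs1 (place_abs pw)) ln1 oppr0.
- by move=> u [].
- move=> u z [u0 Su] [z0 Sz]; split; first exact: mulf_neq0.
  move=> p np nS w pw; rewrite /valuation (absM u z (place_abs pw)).
  rewrite lnM ?posrE ?(Sabs _ _ _ pw) // opprD.
  by have := Su p np nS w pw; have := Sz p np nS w pw; rewrite /valuation => -> ->; rewrite addr0.
- move=> u [u0 Su]; split; first by rewrite invr_eq0.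
  move=> p np nS w pw; rewrite /valuation (absV u (place_abs pw)).
  by rewrite lnV ?posrE ?(Sabs _ _ _ pw) // -/(valuation w u) (Su p np nS w pw) oppr0.
- move=> [i|h] u z [u0 _] [z0 _].
    by have [vM v_gt0 _] := vP i; rewrite vM lnM // posrE v_gt0.
  by rewrite !rmorphM /= absM // lnM // posrE a_gt0.
(* Where [v i m < 1], multiplication by [m ^ N i] makes the value at most 1 for every element with
   logarithm at most [B]. *)
move=> B; pose N i := Num.bound `|B / - ln (v i m%:R)|.
pose M := (m ^ (\sum_(i < r) N i))%N.
have M0 : (0 < M)%N by rewrite expn_gt0 m0.
have Mk0 : (M%:R : k) != 0 by rewrite ((pcharf0P k).1 k0) -lt0n.
have [s sP] := @bounded_integral_finite R k F j a (M%:R * expR B) aa aint.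
exists [seq z / M%:R | z <- s] => u [u0 Su] uB.
apply/mapP; exists (M%:R * u); last by rewrite mulrAC mulfV // mul1r.
apply: sP; last first.
  move=> h; rewrite rmorphM rmorphM /= absM // !rmorph_nat.
  have -> : a M%:R = M%:R by have := aint M; rewrite ger0_norm.
  rewrite ler_pM2l ?ltr0n // -ler_ln ?posrE ?expR_gt0 ?a_gt0 // expRK.
  exact: (uB (inr h)).
(* A failure of integrality is detected at a nonarchimedean place: outside [S] this contradicts that
   [u] is an [S]-unit, and in [S] the choice of [M]. *)
apply: contrapT => nint; have [w [wa wu w1]] := nonintegral_abs R nint.
have wul : ultrametric w by split.
have nt : exists2 z, z != 0 & w z != 1.
  by exists (M%:R * u); rewrite ?mulf_neq0 // gt_eqF.
have [p np pw] := place_of_ultrametric wul nt.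
have [Sp|nSp] := pselect (S p); last first.
  have := Su p np nSp w pw; rewrite /valuation => /eqP; rewrite oppr_eq0 => /eqP lnw.
  have wu1 : w u = 1 by rewrite -[LHS]lnK ?posrE ?(Sabs _ _ _ pw) // lnw expR0.
  by move: w1; rewrite absM // wu1 mulr1 ltNge (ultrametric_int M wul).
have [i pvi vi1] := vm p Sp np.
suff : v i (M%:R * u) <= 1.
  by move=> /(place_le1 pvi pw); rewrite leNgt w1.
have [vM v_gt0 v_1] := vP i.
have m_k0 : (m%:R : k) != 0 by rewrite ((pcharf0P k).1 k0) -lt0n.
have vX e : v i (m%:R ^+ e) = v i m%:R ^+ e.
  by elim: e => [|e IH]; rewrite ?expr0 // !exprS vM IH.
have vmgt := v_gt0 _ m_k0.
have lnm : ln (v i m%:R) < 0 by rewrite ln_lt0 // vmgt.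
rewrite -ler_ln ?posrE ?v_gt0 ?mulf_neq0 // ln1 vM lnM ?posrE ?v_gt0 //.
rewrite /M natrX vX lnXn // -lerBrDr sub0r.
have uBi := uB (inl i); rewrite /= in uBi.
rewrite lerNr -mulNrn; apply: le_trans uBi _.
have lam0 : 0 < - ln (v i m%:R) by rewrite oppr_gt0.
have NB : B <= (N i)%:R * - ln (v i m%:R).
  rewrite -ler_pdivrMr //; apply: le_trans (ler_norm _) (ltW _).
  exact: archi_boundP.
apply: le_trans NB _; rewrite -[X in _ <= X]mulr_natl ler_pM2r // ler_nat.
by rewrite (bigD1 i) //= leq_addr.
Qed.

(** The norm of an element [v] of [k] is its power by the order of the Galois group, so [z * v] has
    the required norm. *)
Lemma is_norm_mulX (k : fieldType) (K : splittingFieldType k) (a v : k) (z : K) :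
  a != 0 -> v != 0 -> galNorm 1 {:K} z = a%:A ->
  is_norm K (a * v ^+ #|'Gal({:K} / 1)%g|).
Proof.
move=> a0 v0 zE; exists (z * v%:A).
  rewrite mulf_neq0 //; last by rewrite scaler_eq0 negb_or v0 oner_neq0.
  by rewrite -(galNorm_eq0 1 {:K}) zE scaler_eq0 negb_or a0 oner_neq0.
rewrite galNormM zE.
have -> : galNorm 1 {:K} v%:A = (v ^+ #|'Gal({:K} / 1)%g|)%:A.
  rewrite /galNorm (eq_bigr (fun=> v%:A)).
    by rewrite prodr_const -[_%:A]/(in_alg K _) -rmorphXn.
  by move=> s _; apply: rmorph_alg.
by rewrite -[a%:A]/(in_alg K _) -[_%:A]/(in_alg K _) -rmorphM.
Qed.

Close Scope classical_set_scope.
Close Scope ring_scope.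

Theorem corollary1p2 (R : realType) (k : fieldExtType rat)
    (gT : finGroupType) (G : {group gT}) (hG : abelian G)
    (S : set (place R k)) (hS : finite_set S) :
  exists K : splittingFieldType k,
    [/\ galois 1 {:K}, 'Gal({:K} / 1) \isog G
      & forall a : k, S_unit S a -> is_norm K a].
Proof.
have [As [As0 AsP]] := S_unit_classes hS (cardG_gt0 G).
have [K [isoK normK]] := prescribed_norms As0 hG.
exists K; split=> //; first exact: galois1f.
move=> a /AsP[b bA [v v0 ->]]; have [z zE] := normK b bA.
rewrite -(card_isog isoK); apply: is_norm_mulX zE => //.
by apply: contraNneq As0 => <-.
Qed.
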